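(* Let $\Lambda=kQ/I$ be a non trivial local bound quiver algebra. Then $\Lambda$ is of infinite + global dimension and of infinite co+ global dimension. Therefore $\mathsf{HH}_*^\tau(\Lambda,\Lambda)$ and $\mathsf{HH}^*_\tau(\Lambda,\Lambda)$ are infinite.
   Context: Let $k$ be a field. All modules and bimodules are finite dimensional over $k$; $D=\mathrm{Hom}_k(-,k)$; $\otimes=\otimes_k$. Bound quiver algebra: $Q$ is a finite quiver with vertex set $Q_0$, $F$ is the ideal of $kQ$ generated by the arrows, $I$ is an admissible ideal ($F^m\subset I\subset F^2$ for some $m\ge 2$), and $\Lambda=kQ/I$. It is local exactly when $Q$ has a unique vertex, and non trivial local means that in addition $Q$ has at least one loop (equivalently $\Lambda\neq k$). Paths are composed from right to left, so $y\Lambda x$ is spanned by the classes of paths from $x$ to $y$. For $x\in Q_0$, ${}_xk$ (resp. $k_x$) is the simple left (resp. right) $\Lambda$-module at $x$. A graded vector space $V_*$ is infinite if $V_n\neq 0$ for infinitely many $n$. $\Lambda$ has infinite + global dimension (resp. infinite co+ global dimension) if there is a pair of vertices $(y,x)$ with $y\Lambda x\neq 0$ and $\mathrm{Tor}^\Lambda_*(k_x,{}_yk)$ infinite (resp. $y\Lambda x\ne 0$ and $\mathrm{Tor}^\Lambda_*(k_y,{}_xk)$ infinite). $\tau$-Hochschild (co)homology: $\Lambda$-bimodules are left $\Lambda\otimes\Lambda^{\mathrm{op}}$-modules, and $\mathrm{Hom}_{\Lambda-\Lambda}$ denotes bimodule morphisms. $\Omega^{m}$ is the $m$-th syzygy of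 bimodules taken with minimal projective resolutions ($\Omega^0=\mathrm{id}$); $\mathrm{Tr}M$ is the transpose, i.e. the cokernel of $\mathrm{Hom}(P_0,\Lambda\otimes\Lambda^{\mathrm{op}})\to\mathrm{Hom}(P_1,\Lambda\otimes\Lambda^{\mathrm{op}})$ for a minimal projective presentation $P_1\to P_0\to M\to 0$; $\tau=D\,\mathrm{Tr}$ for $\Lambda$-bimodules; $\tau_n=\tau\Omega^{n-1}$ for $n\ge1$. For a $\Lambda$-bimodule $X$ and $n\geq 1$: $\mathsf{HH}^n_\tau(\Lambda,X)=D\,\mathrm{Hom}_{\Lambda-\Lambda}(X,\tau_n\Lambda)$ and $\mathsf{HH}_n^\tau(\Lambda,X)=\mathrm{Hom}_{\Lambda-\Lambda}(DX,\tau_n\Lambda)$. *)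

(* Defs.v *)
From HB Require Import structures.
From mathcomp Require Import all_boot all_algebra all_field.
From mathcomp Require Import finmap monalg boolp zify.
Set Implicit Arguments.
Unset Strict Implicit.
Unset Printing Implicit Defensive.
Import GRing.Theory.
Local Open Scope ring_scope.

Record quiver := Quiver {
  vert : finType;
  arrow : finType;
  src : arrow -> vert;
  tgt : arrow -> vert }.

Section Paths.
Variable Q : quiver.

Definition endpoint (x : vert Q) (s : seq (arrow Q)) : vert Q :=
  if s is a :: _ then tgt a else x.

Fixpoint wf_path (x : vert Q) (s : seq (arrow Q)) : bool :=
  if s is a :: s' then (src a == endpoint x s') && wf_path x s' else true.

(* A path is its source together with the list of its arrows, written from right
   to left: the head of the list is the last arrow. *)
Record qpath := QPath {
  qpath_val : vert Q * seq (arrow Q);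
  qpath_wf : wf_path qpath_val.1 qpath_val.2 }.

HB.instance Definition _ := [isSub for qpath_val].
HB.instance Definition _ := [Choice of qpath by <:].

Definition qsrc (p : qpath) : vert Q := (val p).1.
Definition qtgt (p : qpath) : vert Q := endpoint (val p).1 (val p).2.

Definition triv_path (x : vert Q) : qpath := @QPath (x, [::]) isT.
Definition arrow_path (a : arrow Q) : qpath :=
  @QPath (src a, [:: a]) (introT andP (conj (eqxx (src a)) isT)).

Lemma wf_cat (p q : qpath) : qsrc p = qtgt q ->
  wf_path (qsrc q) ((val p).2 ++ (val q).2).
Proof.
case: p q => [[x s] /= ws] [[y t] /= wt]; rewrite /qsrc /qtgt /= => xE.
elim: s ws => //= a s IH /andP[/eqP aE ws]; rewrite IH // andbT aE.
by case: (s) => //=; rewrite xE.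
Qed.

(* First q, then p. *)
Definition qcat (p q : qpath) (h : qsrc p = qtgt q) : qpath :=
  @QPath (qsrc q, (val p).2 ++ (val q).2) (wf_cat h).

Lemma qtgt_cat p q (h : qsrc p = qtgt q) : qtgt (qcat h) = qtgt p.
Proof. by move: h; case: p => [[x [|a s]] wp]; rewrite /qsrc /qtgt /=. Qed.

End Paths.

Section PathAlgebra.
Variables (k : fieldType) (Q : quiver).

Definition path_algebra := {malg k[qpath Q]}.
HB.instance Definition _ := GRing.Lmodule.on path_algebra.

Definition path_elt (p : qpath Q) : path_algebra := << p >>.

Definition path_mul (p q : qpath Q) : path_algebra :=
  if @eqP _ (qsrc p) (qtgt q) is ReflectT h then path_elt (qcat h) else 0.

Definition pa_mul_def (f g : path_algebra) : path_algebra :=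
  \sum_(p <- msupp f) \sum_(q <- msupp g) (f@_p * g@_q) *: path_mul p q.
(* Locked, as unification otherwise unfolds the sums. *)
Fact pa_mul_key : unit. Proof. by []. Qed.
Definition pa_mul := locked_with pa_mul_key pa_mul_def.

Lemma pa_mulE f g : pa_mul f g =
  \sum_(p <- msupp f) \sum_(q <- msupp g) (f@_p * g@_q) *: path_mul p q.
Proof. by rewrite /pa_mul; case: pa_mul_key. Qed.

Definition pa_one : path_algebra := \sum_(x : vert Q) path_elt (triv_path x).

Local Open Scope fset_scope.
Implicit Types f g h : path_algebra.

Lemma pa_mulw (d1 d2 : {fset qpath Q}) f g :
  msupp f `<=` d1 -> msupp g `<=` d2 ->
  pa_mul f g = \sum_(p <- d1) \sum_(q <- d2) (f@_p * g@_q) *: path_mul p q.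
Proof.
move=> le1 le2; rewrite pa_mulE (big_fset_incl _ le1) /=.
  apply/eq_bigr => p _; apply/big_fset_incl => // q _ /mcoeff_outdom ->.
  by rewrite mulr0 scale0r.
move=> p _ /mcoeff_outdom fp.
by rewrite big1 // => q _; rewrite fp mul0r scale0r.
Qed.

Lemma pa_mulDl : left_distributive pa_mul +%R.
Proof.
move=> f g h; set d := msupp f `|` msupp g.
rewrite [in LHS](@pa_mulw d (msupp h)) ?msuppD_le //.
rewrite [pa_mul f h](@pa_mulw d (msupp h)) ?fsubsetUl //.
rewrite [pa_mul g h](@pa_mulw d (msupp h)) ?fsubsetUr //.
rewrite -big_split; apply/eq_bigr => p _ /=; rewrite -big_split.
by apply/eq_bigr => q _ /=; rewrite mcoeffD mulrDl scalerDl.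
Qed.

Lemma pa_mulDr : right_distributive pa_mul +%R.
Proof.
move=> h f g; set d := msupp f `|` msupp g.
rewrite [in LHS](@pa_mulw (msupp h) d) ?msuppD_le //.
rewrite [pa_mul h f](@pa_mulw (msupp h) d) ?fsubsetUl //.
rewrite [pa_mul h g](@pa_mulw (msupp h) d) ?fsubsetUr //.
rewrite -big_split; apply/eq_bigr => p _ /=; rewrite -big_split.
by apply/eq_bigr => q _ /=; rewrite mcoeffD mulrDr scalerDl.
Qed.

Lemma pa_mul0l : left_zero 0 pa_mul.
Proof. by move=> g; rewrite pa_mulE msupp0 big_seq_fset0. Qed.

Lemma pa_mul0r : right_zero 0 pa_mul.
Proof. by move=> g; rewrite pa_mulE big1 // => p _; rewrite msupp0 big_seq_fset0. Qed.

Lemma pa_mulZl c f g : pa_mul (c *: f) g = c *: pa_mul f g.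
Proof.
rewrite (@pa_mulw (msupp f) (msupp g)) ?msuppZ_le // pa_mulE scaler_sumr.
apply/eq_bigr => p _; rewrite scaler_sumr; apply/eq_bigr => q _.
by rewrite mcoeffZ scalerA mulrA.
Qed.

Lemma pa_mulZr c f g : pa_mul f (c *: g) = c *: pa_mul f g.
Proof.
rewrite (@pa_mulw (msupp f) (msupp g)) ?msuppZ_le // pa_mulE scaler_sumr.
apply/eq_bigr => p _; rewrite scaler_sumr; apply/eq_bigr => q _.
by rewrite mcoeffZ scalerA !mulrA [c * _]mulrC.
Qed.

Lemma pa_mulUU p q : pa_mul (path_elt p) (path_elt q) = path_mul p q.
Proof.
by rewrite (@pa_mulw [fset p] [fset q]) ?msuppU_le // !big_seq_fset1 !mcoeffUU
  mulr1 scale1r.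
Qed.

Lemma pa_suml (I : Type) (r : seq I) (F : I -> path_algebra) g :
  pa_mul (\sum_(i <- r) F i) g = \sum_(i <- r) pa_mul (F i) g.
Proof.
by apply: (big_morph (pa_mul^~ g)) => [? ?|]; rewrite ?pa_mulDl ?pa_mul0l.
Qed.

Lemma pa_sumr (I : Type) (r : seq I) (F : I -> path_algebra) g :
  pa_mul g (\sum_(i <- r) F i) = \sum_(i <- r) pa_mul g (F i).
Proof. by apply: (big_morph (pa_mul g)) => [? ?|]; rewrite ?pa_mulDr ?pa_mul0r. Qed.

Lemma paE f : f = \sum_(p <- msupp f) f@_p *: path_elt p.
Proof.
rewrite {1}[f]monalgE; apply: eq_bigr => p _; apply/malgP => q.
rewrite [RHS]mcoeffZ [LHS]mcoeffU (mcoeffU p 1 q) mulr_natr.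
by [].
Qed.

Lemma paP f : exists (s : seq (qpath Q)) (c : qpath Q -> k),
  f = \sum_(p <- s) c p *: path_elt p.
Proof. by exists (msupp f), (fun p => f@_p); apply: paE. Qed.

Lemma path_mulE p q (h : qsrc p = qtgt q) : path_mul p q = path_elt (qcat h).
Proof.
rewrite /path_mul; case: eqP => [h'|/(_ h)[]].
by rewrite (eq_irrelevance h' h).
Qed.

Lemma path_mul0 p q : qsrc p <> qtgt q -> path_mul p q = 0.
Proof. by rewrite /path_mul; case: eqP. Qed.

Lemma path_mulA p q r :
  pa_mul (path_elt p) (path_mul q r) = pa_mul (path_mul p q) (path_elt r).
Proof.
have m0l := pa_mul0l; have m0r := pa_mul0r.
have UU := pa_mulUU; have ME := path_mulE; have M0 := path_mul0.
move: pa_mul path_mul path_elt m0l m0r UU ME M0 => mul pm e m0l m0r UU ME M0.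
case: (@eqP _ (qsrc q) (qtgt r)) => [qr|nqr];
  case: (@eqP _ (qsrc p) (qtgt q)) => [pq|npq].
- have pqr : qsrc p = qtgt (qcat qr) by rewrite qtgt_cat.
  rewrite (ME _ _ qr) (ME _ _ pq) !UU (ME _ _ pqr) (ME (qcat pq) r qr).
  by congr e; apply/val_inj; rewrite /= catA.
- by rewrite (ME _ _ qr) (M0 _ _ npq) m0l UU M0 // qtgt_cat.
- by rewrite (ME _ _ pq) (M0 _ _ nqr) m0r UU M0.
- by rewrite (M0 _ _ npq) (M0 _ _ nqr) m0l m0r.
Qed.

Lemma pa_mulA : associative pa_mul.
Proof.
have sl := pa_suml; have sr := pa_sumr; have Zl := pa_mulZl; have Zr := pa_mulZr.
have UU p q r : pa_mul (path_elt p) (pa_mul (path_elt q) (path_elt r))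
    = pa_mul (pa_mul (path_elt p) (path_elt q)) (path_elt r).
  apply: etrans (congr1 (pa_mul _) (pa_mulUU q r)) _.
  exact: etrans (path_mulA p q r) (congr1 (pa_mul^~ _) (esym (pa_mulUU p q))).
have eP := paP.
move: pa_mul path_elt sl sr Zl Zr UU eP => mul e sl sr Zl Zr UU eP f g h.
have [s [c ->]] := eP f; rewrite !sl; apply/eq_bigr => p _; rewrite !Zl.
have [t [d ->]] := eP g; rewrite sr !sl sr; congr (_ *: _).
apply/eq_bigr => q _.
apply: etrans (congr1 (mul (e p)) (Zl (d q) (e q) h)) _.
apply: etrans (Zr (d q) (e p) (mul (e q) h)) _.
apply/esym; apply: etrans (congr1 (mul^~ h) (Zr (d q) (e p) (e q))) _.
apply: etrans (Zl (d q) (mul (e p) (e q)) h) _.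
apply/esym; congr (_ *: _).
have [u [v ->]] := eP h; rewrite !sr; apply/eq_bigr => r _.
by rewrite !Zr UU.
Qed.

Lemma pa_mul1l : left_id pa_one pa_mul.
Proof.
have sl := pa_suml; have sr := pa_sumr; have Zr := pa_mulZr; have eP := paP.
have UU := pa_mulUU; have ME := path_mulE; have M0 := path_mul0.
rewrite /pa_one; move: pa_mul path_mul path_elt sl sr Zr eP UU ME M0.
move=> mul pm e sl sr Zr eP UU ME M0 f.
have [s [c ->]] := eP f; rewrite sr; apply/eq_bigr => p _.
rewrite Zr sl; congr (_ *: _).
rewrite (bigD1 (qtgt p)) //= big1 => [|x /eqP xp]; last by rewrite UU M0.
rewrite addr0 UU (ME (triv_path (qtgt p)) p erefl).
by congr e; apply/val_inj; case: (p) => [[]].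
Qed.

Lemma pa_mul1r : right_id pa_one pa_mul.
Proof.
have sl := pa_suml; have sr := pa_sumr; have Zl := pa_mulZl; have eP := paP.
have UU := pa_mulUU; have ME := path_mulE; have M0 := path_mul0.
rewrite /pa_one; move: pa_mul path_mul path_elt sl sr Zl eP UU ME M0.
move=> mul pm e sl sr Zl eP UU ME M0 f.
have [s [c ->]] := eP f; rewrite sl; apply/eq_bigr => p _.
rewrite Zl sr; congr (_ *: _).
rewrite (bigD1 (qsrc p)) //= big1 => [|x /eqP xp]; last first.
  by rewrite UU M0 //; apply/nesym.
rewrite addr0 UU (ME p (triv_path (qsrc p)) erefl).
by congr e; apply/val_inj; case: (p) => [[] ? ? /=]; rewrite cats0.
Qed.

HB.instance Definition _ := GRing.Zmodule_isPzRing.Build path_algebra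
  pa_mulA pa_mul1l pa_mul1r pa_mulDl pa_mulDr.

End PathAlgebra.

Section BoundQuiverAlgebra.
Variables (k : fieldType) (Q : quiver).
Local Notation kQ := (path_algebra k Q).
Implicit Types (I J : kQ -> Prop) (f g h : kQ).

Definition is_ideal J :=
  [/\ J 0, forall f g, J f -> J g -> J (f + g),
      forall h f, J f -> J (h * f) & forall f h, J f -> J (f * h)].

Definition ideal_gen (S : kQ -> Prop) : kQ -> Prop :=
  fun f => forall J, is_ideal J -> (forall g, S g -> J g) -> J f.

Definition ideal_mul I J : kQ -> Prop :=
  ideal_gen (fun f => exists g h, [/\ I g, J h & f = g * h]).

Definition ideal_exp J (m : nat) : kQ -> Prop :=
  iter m (ideal_mul J) (fun=> True).

Definition arrow_ideal : kQ -> Prop :=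
  ideal_gen (fun f => exists a : arrow Q, f = path_elt k (arrow_path a)).

Definition admissible I :=
  is_ideal I /\
  exists m : nat, [/\ (2 <= m)%N,
    forall f, ideal_exp arrow_ideal m f -> I f &
    forall f, I f -> ideal_exp arrow_ideal 2 f].

Lemma mcoeff_triv_mul f g (x : vert Q) :
  (f * g)@_(triv_path x) = f@_(triv_path x) * g@_(triv_path x).
Proof.
have UU p q : (path_mul k p q)@_(triv_path x) =
    (p == triv_path x)%:R * (q == triv_path x)%:R.
  case: (@eqP _ (qsrc p) (qtgt q)) => [h|h]; last first.
    rewrite path_mul0 // mcoeff0; case: (eqVneq p) => [pE|_]; last by rewrite mul0r.
    case: (eqVneq q) => [qE|_]; last by rewrite mulr0.
    by case: h; rewrite pE qE.
  rewrite path_mulE mcoeffU -natrM mulnb; congr (_ *+ nat_of_bool _).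
  apply/eqP/andP => [/(congr1 val)|[/eqP pE /eqP qE]]; last first.
    by apply/val_inj; rewrite /= pE qE.
  case: p q h => [[y [|a s]] wp] [[z [|b t]] wq];
    rewrite /= /qsrc /qtgt //= => h [zx].
  by split; apply/eqP/val_inj; rewrite /= ?h zx.
have coefE f' :
    \sum_(p <- msupp f') f'@_p * (p == triv_path x)%:R = f'@_(triv_path x).
  rewrite {3}[f']paE raddf_sum; apply: eq_bigr => p _ /=.
  by rewrite mcoeffZ mcoeffU.
rewrite -(coefE f) -(coefE g) big_distrlr /= -[f * g]/(pa_mul f g) pa_mulE.
rewrite raddf_sum; apply: eq_bigr => p _; rewrite raddf_sum; apply: eq_bigr => q _ /=.
by rewrite mcoeffZ UU mulrACA.
Qed.

Lemma ideal_triv_eq0 (x : vert Q) : is_ideal (fun f => f@_(triv_path x) = 0).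
Proof.
split=> [|f g f0 g0|h f f0|f h f0]; first exact: mcoeff0.
- by rewrite mcoeffD f0 g0 addr0.
- by rewrite mcoeff_triv_mul f0 mulr0.
- by rewrite mcoeff_triv_mul f0 mul0r.
Qed.

Lemma arrow_ideal_triv f x : arrow_ideal f -> f@_(triv_path x) = 0.
Proof.
move/(_ _ (ideal_triv_eq0 x)); apply=> _ [a ->].
by rewrite mcoeffU; case: eqP => // /(congr1 val) [].
Qed.

Lemma admissible_triv I f x : admissible I -> I f -> f@_(triv_path x) = 0.
Proof.
case=> _ [m [_ _ IF2]] /IF2 /(_ _ (ideal_triv_eq0 x)); apply.
move=> _ [g [h [/(arrow_ideal_triv x) g0 _ ->]]].
by rewrite mcoeff_triv_mul g0 mul0r.
Qed.

End BoundQuiverAlgebra.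

(* [bqa_alg] is the quotient kQ/I, given up to isomorphism by a surjective
   algebra morphism from kQ with kernel I. *)
Record bound_quiver_algebra (k : fieldType) := BoundQuiverAlgebra {
  bqa_quiver : quiver;
  bqa_ideal : path_algebra k bqa_quiver -> Prop;
  bqa_admissible : admissible bqa_ideal;
  bqa_alg :> falgType k;
  bqa_proj : {linear path_algebra k bqa_quiver -> bqa_alg};
  bqa_proj_morph : monoid_morphism bqa_proj;
  bqa_proj_surj : forall a : bqa_alg, exists f, bqa_proj f = a;
  bqa_proj_ker : forall f, bqa_proj f = 0 <-> bqa_ideal f }.

Section Characters.
Variables (k : fieldType) (L : bound_quiver_algebra k).

Definition idem (x : vert (bqa_quiver L)) : L := bqa_proj L (path_elt k (triv_path x)).

(* The algebra map L -> k sending e_x to 1 and all other vertices and all arrows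
   to 0; by [bqa_charE] it does not depend on the chosen preimage. *)
Definition bqa_char (x : vert (bqa_quiver L)) (a : L) : k :=
  (projT1 (cid (bqa_proj_surj a)))@_(triv_path x).

Lemma bqa_charE x f : bqa_char x (bqa_proj L f) = f@_(triv_path x).
Proof.
rewrite /bqa_char; case: cid => g /= gE; apply/eqP; rewrite -subr_eq0 -mcoeffB.
apply/eqP; apply: (admissible_triv _ (bqa_admissible L)).
by apply/bqa_proj_ker; rewrite linearB /= gE subrr.
Qed.

Lemma bqa_char_linear x : linear_for *%R (bqa_char x).
Proof.
move=> c a b; have [f <-] := bqa_proj_surj a; have [g <-] := bqa_proj_surj b.
by rewrite -linearP !bqa_charE mcoeffD mcoeffZ.
Qed.

Lemma bqa_char_monoid_morphism x : monoid_morphism (bqa_char x).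
Proof.
have [p1 pM] := bqa_proj_morph L; split=> [|a b].
  rewrite -p1 bqa_charE [1]/(pa_one k _) raddf_sum (bigD1 x) //= mcoeffUU.
  rewrite big1 ?addr0 // => y /eqP yx.
  by rewrite mcoeffU; case: eqP => // /(congr1 val) [].
have [f <-] := bqa_proj_surj a; have [g <-] := bqa_proj_surj b.
by rewrite -pM !bqa_charE mcoeff_triv_mul.
Qed.

End Characters.

Section Subspaces.
Variables (k : fieldType) (V : vectType k).

Lemma vspace_exists (P : V -> Prop) : P 0 ->
  (forall c u v, P u -> P v -> P (c *: u + v)) ->
  exists U : {vspace V}, forall v, v \in U <-> P v.
Proof.
move=> P0 Plin.
suff H n (U : {vspace V}) : (\dim {:V} - \dim U < n)%N ->
    (forall v, v \in U -> P v) -> exists W : {vspace V}, forall v, v \in W <-> P v.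
  apply: (H (\dim {:V}).+1 0%VS); first by rewrite ltnS leq_subr.
  by move=> v; rewrite memv0 => /eqP ->.
elim: n U => // n IH U dimU UP.
have [[v [Pv vU]]|nex] := pselect (exists v, P v /\ v \notin U).
  have UvP w : w \in (<[v]> + U)%VS -> P w.
    by case/memv_addP=> _ /vlineP[c ->] [u uU ->]; apply: Plin => //; apply: UP.
  apply: (IH (<[v]> + U)%VS) => //.
  have ltU : (\dim U < \dim (<[v]> + U))%N.
    have sU : (U <= <[v]> + U)%VS by apply: addvSr.
    rewrite ltn_neqAle dimvS // andbT; apply: contraNN vU => /eqP dE.
    have/eqP -> : U == (<[v]> + U)%VS by rewrite eqEdim sU dE leqnn.
    by rewrite (subvP (addvSl _ _)) // memv_line.
  have := dimvS (subvf (<[v]> + U)); move: dimU ltU; clear.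
  move: (\dim _) (\dim _) (\dim _) => a b c; lia.
exists U => v; split; first exact: UP.
by move=> Pv; case: (boolP (v \in U)) => // vU; case: nex; exists v.
Qed.

Lemma vspan_fact (S : V -> Prop) :
  exists U : {vspace V}, forall v, v \in U <->
    (forall W : {vspace V}, (forall s, S s -> s \in W) -> v \in W).
Proof.
apply: vspace_exists => [W _|c u v Pu Pv W SW]; first exact: mem0v.
by rewrite rpredD ?rpredZ ?Pu ?Pv.
Qed.

Definition vspan (S : V -> Prop) : {vspace V} := projT1 (cid (vspan_fact S)).

Lemma vspanP (S : V -> Prop) v : v \in vspan S <->
  (forall W : {vspace V}, (forall s, S s -> s \in W) -> v \in W).
Proof. by rewrite /vspan; case: cid. Qed.

(* The quotient V / U, modelled on a complement of U. *)
Definition quotv (U : {vspace V}) : vectType k := subvs_of (U^C)%VS.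

Definition quotv_pi (U : {vspace V}) : 'Hom(V, quotv U) :=
  (linfun (vsproj (U^C)%VS) \o daddv_pi (U^C)%VS U)%VF.

Lemma quotv_piK (U : {vspace V}) (w : quotv U) : quotv_pi U (vsval w) = w.
Proof.
rewrite comp_lfunE lfunE /= daddv_pi_id ?vsvalK ?subvsP //.
by rewrite capvC capv_compl.
Qed.

Lemma quotv_pi_eq0 (U : {vspace V}) v : (quotv_pi U v == 0) = (v \in U).
Proof.
have capC : (U^C :&: U = 0)%VS by rewrite capvC capv_compl.
have vE : daddv_pi (U^C)%VS U v + daddv_pi U (U^C)%VS v = v.
  by apply: daddv_pi_add; rewrite // addvC addv_complf memvf.
rewrite comp_lfunE lfunE /= -(inj_eq val_inj) /= vsprojK ?memv_pi //.
apply/eqP/idP => [v0|vU]; first by rewrite -vE v0 add0r memv_pi.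
apply/eqP; rewrite -memv0 -capC memv_cap memv_pi /=.
by rewrite -[X in X \in _](addrK (daddv_pi U (U^C)%VS v)) vE rpredB ?memv_pi.
Qed.

Lemma quotv_pi_val (U : {vspace V}) v : vsval (quotv_pi U v) - v \in U.
Proof. by rewrite -quotv_pi_eq0 linearB /= quotv_piK subrr. Qed.

End Subspaces.

Section LinearMaps.
Variables (k : fieldType) (V W : vectType k).

Definition mklfun (f : V -> W) (fL : linear f) : 'Hom(V, W) := linfun f.

Lemma mklfunE (f : V -> W) (fL : linear f) v : mklfun fL v = f v.
Proof.
pose mf := GRing.isSemilinear.Build k V W _ f (GRing.semilinear_linear fL).
pose F : {linear V -> W} := HB.pack f mf.
exact: (lfunE F v).
Qed.

End LinearMaps.

Section TensorSpaces.
Variable k : fieldType.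
Implicit Types V W : vectType k.

Definition dualv V : vectType k := 'Hom(V, k^o).

Fact lfdual_linear V W (f : 'Hom(V, W)) :
  linear (fun phi : dualv W => (phi \o f)%VF : dualv V).
Proof. by move=> c u v; rewrite comp_lfunDl -comp_lfunZl. Qed.

Definition lfdual V W (f : 'Hom(V, W)) : 'Hom(dualv W, dualv V) :=
  mklfun (lfdual_linear f).

Lemma lfdualE V W (f : 'Hom(V, W)) phi : lfdual f phi = (phi \o f)%VF.
Proof. exact: mklfunE. Qed.

(* V (x) W for finite dimensional V and W, through the canonical isomorphism
   V (x) W = Hom(D V, W) sending v (x) w to phi |-> phi(v) w. *)
Definition tensv V W : vectType k := 'Hom(dualv V, W).

Fact pure_tens_linear V W (v : V) (w : W) :
  linear (fun phi : dualv V => (phi v : k) *: w).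
Proof. by move=> c f g; rewrite !lfunE /= lfunE scalerDl scalerA. Qed.

Definition pure_tens V W (v : V) (w : W) : tensv V W :=
  mklfun (pure_tens_linear v w).

Lemma pure_tensE V W (v : V) (w : W) phi :
  pure_tens v w phi = (phi v : k) *: w.
Proof. exact: mklfunE. Qed.

Fact tens_map_linear V W V' W' (f : 'Hom(V, V')) (g : 'Hom(W, W')) :
  linear (fun t : tensv V W => (g \o (t \o lfdual f))%VF : tensv V' W').
Proof.
by move=> c s t; rewrite comp_lfunDl -comp_lfunZl comp_lfunDr -comp_lfunZr.
Qed.

Definition tens_map V W V' W' (f : 'Hom(V, V')) (g : 'Hom(W, W')) :
  'Hom(tensv V W, tensv V' W') := mklfun (tens_map_linear f g).

Lemma tens_mapE V W V' W' (f : 'Hom(V, V')) (g : 'Hom(W, W')) t phi :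
  tens_map f g t phi = g (t (phi \o f)%VF).
Proof. by rewrite [tens_map f g t]mklfunE !comp_lfunE lfdualE. Qed.

Lemma tens_map_pure V W V' W' (f : 'Hom(V, V')) (g : 'Hom(W, W')) v w :
  tens_map f g (pure_tens v w) = pure_tens (f v) (g w).
Proof. by apply/lfunP=> phi; rewrite tens_mapE !pure_tensE comp_lfunE linearZ. Qed.

Lemma tens_map_id V W : tens_map \1 \1 = \1%VF :> 'End(tensv V W).
Proof.
apply/lfunP=> t; apply/lfunP=> phi.
by rewrite tens_mapE !id_lfunE comp_lfun1r.
Qed.

Lemma tens_map_comp V W V' W' V'' W'' (f' : 'Hom(V', V'')) (g' : 'Hom(W', W''))
    (f : 'Hom(V, V')) (g : 'Hom(W, W')) :
  (tens_map f' g' \o tens_map f g = tens_map (f' \o f) (g' \o g))%VF.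
Proof.
apply/lfunP=> t; apply/lfunP=> phi.
by rewrite comp_lfunE !tens_mapE comp_lfunE comp_lfunA.
Qed.

Fact tens_mapl_linear V W V' (g : 'End(W)) :
  linear (fun f : 'Hom(V, V') => tens_map f g).
Proof.
move=> c f f'; apply/lfunP=> t; apply/lfunP=> phi.
rewrite add_lfunE scale_lfunE add_lfunE scale_lfunE !tens_mapE.
by rewrite comp_lfunDr -comp_lfunZr !linearP.
Qed.

Fact tens_mapr_linear V W W' (f : 'End(V)) :
  linear (fun g : 'Hom(W, W') => tens_map f g).
Proof.
move=> c g g'; apply/lfunP=> t; apply/lfunP=> phi.
rewrite add_lfunE scale_lfunE add_lfunE scale_lfunE !tens_mapE.
by rewrite add_lfunE scale_lfunE.
Qed.

End TensorSpaces.

(* Left A-modules are (A, k)-bimodules and right A-modules (k, A)-bimodules. *)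
Record bimodule (k : fieldType) (A B : falgType k) := Bimodule {
  bim_sort :> vectType k;
  lact : A -> 'End(bim_sort);
  ract : B -> 'End(bim_sort);
  lact_linear : linear lact;
  ract_linear : linear ract;
  lact1 : lact 1 = \1%VF;
  ract1 : ract 1 = \1%VF;
  lactM : forall a a', lact (a * a') = (lact a \o lact a')%VF;
  ractM : forall b b', ract (b * b') = (ract b' \o ract b)%VF;
  lractC : forall a b, (lact a \o ract b)%VF = (ract b \o lact a)%VF }.

Arguments lact {k A B} M a : rename.
Arguments ract {k A B} M b : rename.

Notation lmodule k A := (@bimodule k A (k^o : falgType k)).
Notation rmodule k A := (@bimodule k (k^o : falgType k) A).

Section Bimodules.
Variables (k : fieldType) (A B : falgType k).
Implicit Types M N P : bimodule A B.

Definition bim_hom M N (f : 'Hom(M, N)) :=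
  (forall a, f \o lact M a = lact N a \o f)%VF /\
  (forall b, f \o ract M b = ract N b \o f)%VF.

Fact bim_homspace_fact M N :
  exists U : {vspace 'Hom(M, N)}, forall f, f \in U <-> bim_hom f.
Proof.
apply: vspace_exists => [|c f g [fl fr] [gl gr]].
  by split=> ?; rewrite comp_lfun0l comp_lfun0r.
by split=> ?; rewrite comp_lfunDl -comp_lfunZl comp_lfunDr -comp_lfunZr
  ?fl ?gl ?fr ?gr.
Qed.

Lemma bim_hom_id M : bim_hom (\1%VF : 'End(M)).
Proof. by split=> c; rewrite comp_lfun1l comp_lfun1r. Qed.

Lemma bim_hom_comp M N P (f : 'Hom(N, P)) (g : 'Hom(M, N)) :
  bim_hom f -> bim_hom g -> bim_hom (f \o g)%VF.
Proof.
by case=> fl fr [gl gr]; split=> c;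
  rewrite -comp_lfunA ?gl ?gr comp_lfunA ?fl ?fr comp_lfunA.
Qed.

Definition bim_homspace M N : {vspace 'Hom(M, N)} :=
  projT1 (cid (bim_homspace_fact M N)).

Lemma bim_homspaceP M N f : f \in bim_homspace M N <-> bim_hom f.
Proof. by rewrite /bim_homspace; case: cid. Qed.

Definition bim_stable M (U : {vspace M}) :=
  (forall a u, u \in U -> lact M a u \in U) /\
  (forall b u, u \in U -> ract M b u \in U).

Lemma bim_stable_ker M N (f : 'Hom(M, N)) : bim_hom f -> bim_stable (lker f).
Proof.
case=> fl fr; split=> c u; rewrite !memv_ker -comp_lfunE ?fl ?fr comp_lfunE;
  by move/eqP->; rewrite linear0.
Qed.

Lemma bim_stable_img M N (f : 'Hom(M, N)) : bim_hom f -> bim_stable (limg f).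
Proof.
by case=> fl fr; split=> c _ /memv_imgP[u _ ->]; rewrite -comp_lfunE -?fl -?fr
  comp_lfunE memv_img ?memvf.
Qed.

End Bimodules.

Section SubQuotient.
Variables (k : fieldType) (A B : falgType k) (M : bimodule A B).
Variables (U : {vspace M}) (hU : bim_stable U).

Definition lfsub (f : 'End(M)) : 'End(subvs_of U) :=
  (linfun (vsproj U) \o (f \o linfun vsval))%VF.

Lemma lfsubE (f : 'End(M)) w : (forall u, u \in U -> f u \in U) ->
  vsval (lfsub f w) = f (vsval w).
Proof. by move=> fU; rewrite !comp_lfunE !lfunE /= vsprojK ?fU ?subvsP. Qed.

Fact lfsub_linear : linear lfsub.
Proof.
move=> c f g; rewrite /lfsub comp_lfunDl -comp_lfunZl.
by rewrite comp_lfunDr -comp_lfunZr.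
Qed.

Lemma lfsub_lact a w : vsval (lfsub (lact M a) w) = lact M a (vsval w).
Proof. exact: lfsubE (hU.1 a). Qed.

Lemma lfsub_ract b w : vsval (lfsub (ract M b) w) = ract M b (vsval w).
Proof. exact: lfsubE (hU.2 b). Qed.

Let sub_lact a := lfsub (lact M a).
Let sub_ract b := lfsub (ract M b).

Fact sub_lact_linear : linear sub_lact.
Proof. by move=> c a a'; rewrite /sub_lact lact_linear lfsub_linear. Qed.

Fact sub_ract_linear : linear sub_ract.
Proof. by move=> c b b'; rewrite /sub_ract ract_linear lfsub_linear. Qed.

Fact sub_lact1 : sub_lact 1 = \1%VF.
Proof.
by apply/lfunP=> w; apply/val_inj; rewrite /= lfsub_lact lact1 !id_lfunE.
Qed.

Fact sub_ract1 : sub_ract 1 = \1%VF.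
Proof.
by apply/lfunP=> w; apply/val_inj; rewrite /= lfsub_ract ract1 !id_lfunE.
Qed.

Fact sub_lactM a a' : sub_lact (a * a') = (sub_lact a \o sub_lact a')%VF.
Proof.
apply/lfunP=> w; apply/val_inj; rewrite comp_lfunE /=.
by rewrite !lfsub_lact lactM comp_lfunE.
Qed.

Fact sub_ractM b b' : sub_ract (b * b') = (sub_ract b' \o sub_ract b)%VF.
Proof.
apply/lfunP=> w; apply/val_inj; rewrite comp_lfunE /=.
by rewrite !lfsub_ract ractM comp_lfunE.
Qed.

Fact sub_lractC a b : (sub_lact a \o sub_ract b = sub_ract b \o sub_lact a)%VF.
Proof.
apply/lfunP=> w; apply/val_inj.
rewrite (comp_lfunE (sub_lact a)) (comp_lfunE (sub_ract b)) /=.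
rewrite lfsub_lact !lfsub_ract lfsub_lact.
by rewrite -!comp_lfunE lractC.
Qed.

Definition sub_bimodule : bimodule A B :=
  Bimodule sub_lact_linear sub_ract_linear sub_lact1 sub_ract1
    sub_lactM sub_ractM sub_lractC.

Definition sub_incl : 'Hom(sub_bimodule, M) := linfun (@vsval k M U).

Lemma sub_incl_hom : bim_hom sub_incl.
Proof.
by split=> c; apply/lfunP=> w; rewrite [LHS]comp_lfunE [RHS]comp_lfunE;
  rewrite /sub_incl !(lfunE (@vsval k M U)) /= ?lfsub_lact ?lfsub_ract.
Qed.

Definition lfquot (f : 'End(M)) : 'End(quotv U) :=
  (quotv_pi U \o (f \o linfun vsval))%VF.

Lemma lfquotE (f : 'End(M)) v : (forall u, u \in U -> f u \in U) ->
  lfquot f (quotv_pi U v) = quotv_pi U (f v).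
Proof.
move=> fU; rewrite [LHS]comp_lfunE (comp_lfunE f) (lfunE vsval) /=.
apply/eqP; rewrite -subr_eq0 -!linearB /= quotv_pi_eq0 fU //.
exact: quotv_pi_val.
Qed.

Fact lfquot_linear : linear lfquot.
Proof.
move=> c f g; rewrite /lfquot comp_lfunDl -comp_lfunZl.
by rewrite comp_lfunDr -comp_lfunZr.
Qed.

Lemma lfquot_lact a v : lfquot (lact M a) (quotv_pi U v) = quotv_pi U (lact M a v).
Proof. exact: lfquotE (hU.1 a). Qed.

Lemma lfquot_ract b v : lfquot (ract M b) (quotv_pi U v) = quotv_pi U (ract M b v).
Proof. exact: lfquotE (hU.2 b). Qed.

Let quot_lact a := lfquot (lact M a).
Let quot_ract b := lfquot (ract M b).

Fact quot_lact_linear : linear quot_lact.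
Proof. by move=> c a a'; rewrite /quot_lact lact_linear lfquot_linear. Qed.

Fact quot_ract_linear : linear quot_ract.
Proof. by move=> c b b'; rewrite /quot_ract ract_linear lfquot_linear. Qed.

Fact quot_lact1 : quot_lact 1 = \1%VF.
Proof.
by apply/lfunP=> w; rewrite -(quotv_piK w) lfquot_lact lact1 !id_lfunE.
Qed.

Fact quot_ract1 : quot_ract 1 = \1%VF.
Proof.
by apply/lfunP=> w; rewrite -(quotv_piK w) lfquot_ract ract1 !id_lfunE.
Qed.

Fact quot_lactM a a' : quot_lact (a * a') = (quot_lact a \o quot_lact a')%VF.
Proof.
apply/lfunP=> w; rewrite -(quotv_piK w) (comp_lfunE (quot_lact a)).
by rewrite !lfquot_lact lactM (comp_lfunE (lact M a)).
Qed.

Fact quot_ractM b b' : quot_ract (b * b') = (quot_ract b' \o quot_ract b)%VF.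
Proof.
apply/lfunP=> w; rewrite -(quotv_piK w) (comp_lfunE (quot_ract b')).
by rewrite !lfquot_ract ractM (comp_lfunE (ract M b')).
Qed.

Fact quot_lractC a b :
  (quot_lact a \o quot_ract b = quot_ract b \o quot_lact a)%VF.
Proof.
apply/lfunP=> w; rewrite -(quotv_piK w).
rewrite (comp_lfunE (quot_lact a)) (comp_lfunE (quot_ract b)).
rewrite /quot_ract /quot_lact !(lfquot_lact, lfquot_ract).
by congr (quotv_pi U _); rewrite -!comp_lfunE lractC.
Qed.

Definition quot_bimodule : bimodule A B :=
  Bimodule quot_lact_linear quot_ract_linear quot_lact1 quot_ract1
    quot_lactM quot_ractM quot_lractC.

End SubQuotient.

Section RegularDual.
Variable k : fieldType.

Section Mul.
Variable A : falgType k.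
Implicit Types a b : A.

Fact amulr1E : amulr 1 = \1%VF :> 'End(A).
Proof. by apply/lfunP=> v; rewrite id_lfunE lfunE /= mulr1. Qed.

Fact amull_comp a b : amull (a * b) = (amull a \o amull b)%VF.
Proof. by apply/lfunP=> v; rewrite comp_lfunE !lfunE /= mulrA. Qed.

Fact amulr_comp a b : amulr (a * b) = (amulr b \o amulr a)%VF.
Proof. by apply/lfunP=> v; rewrite comp_lfunE !lfunE /= mulrA. Qed.

Fact amullrC a b : (amull a \o amulr b)%VF = (amulr b \o amull a)%VF.
Proof. by apply/lfunP=> v; rewrite !comp_lfunE !lfunE /= mulrA. Qed.

Definition regular_bimodule : bimodule A A :=
  @Bimodule k A A A (@amull k A) (@amulr k A) (@linearP _ _ _ _ _)
    (@linearP _ _ _ _ _) (@amull1 k A) amulr1E amull_comp amulr_comp amullrC.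

End Mul.

Fact lfdual_linear_in (V W : vectType k) : linear (@lfdual k V W).
Proof.
move=> c f g; apply/lfunP=> phi; rewrite add_lfunE scale_lfunE !lfdualE.
by rewrite comp_lfunDr -comp_lfunZr.
Qed.

Lemma lfdual_comp (V W X : vectType k) (f : 'Hom(W, X)) (g : 'Hom(V, W)) :
  lfdual (f \o g) = (lfdual g \o lfdual f)%VF.
Proof. by apply/lfunP=> phi; rewrite comp_lfunE !lfdualE comp_lfunA. Qed.

Lemma lfdual_id (V : vectType k) : lfdual \1 = \1%VF :> 'End(dualv V).
Proof. by apply/lfunP=> phi; rewrite lfdualE comp_lfun1r id_lfunE. Qed.

Section Dual.
Variables (A B : falgType k) (M : bimodule A B).
Let dual_lact (b : B) : 'End(dualv M) := lfdual (ract M b).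
Let dual_ract (a : A) : 'End(dualv M) := lfdual (lact M a).

Fact dual_lact_linear : linear dual_lact.
Proof. by move=> c a b; rewrite /dual_lact ract_linear lfdual_linear_in. Qed.

Fact dual_ract_linear : linear dual_ract.
Proof. by move=> c a b; rewrite /dual_ract lact_linear lfdual_linear_in. Qed.

Fact dual_lact1 : dual_lact 1 = \1%VF.
Proof. by rewrite /dual_lact ract1 lfdual_id. Qed.

Fact dual_ract1 : dual_ract 1 = \1%VF.
Proof. by rewrite /dual_ract lact1 lfdual_id. Qed.

Fact dual_lactM a b : dual_lact (a * b) = (dual_lact a \o dual_lact b)%VF.
Proof. by rewrite /dual_lact ractM lfdual_comp. Qed.

Fact dual_ractM a b : dual_ract (a * b) = (dual_ract b \o dual_ract a)%VF.
Proof. by rewrite /dual_ract lactM lfdual_comp. Qed.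

Fact dual_lractC b a :
  (dual_lact b \o dual_ract a = dual_ract a \o dual_lact b)%VF.
Proof. by rewrite /dual_lact /dual_ract -!lfdual_comp lractC. Qed.

(* (b phi a)(m) = phi(a m b). *)
Definition dual_bimodule : bimodule B A :=
  Bimodule dual_lact_linear dual_ract_linear dual_lact1 dual_ract1
    dual_lactM dual_ractM dual_lractC.

End Dual.

Section Tens.
Variables A B : falgType k.
Let tens_lact (a : A) : 'End(tensv A B) := tens_map (amull a) \1.
Let tens_ract (b : B) : 'End(tensv A B) := tens_map \1 (amulr b).

Fact tens_lact_linear : linear tens_lact.
Proof. by move=> c a b; rewrite /tens_lact linearP tens_mapl_linear. Qed.

Fact tens_ract_linear : linear tens_ract.
Proof. by move=> c a b; rewrite /tens_ract linearP tens_mapr_linear. Qed.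

Fact tens_lact1 : tens_lact 1 = \1%VF.
Proof. by rewrite /tens_lact amull1 tens_map_id. Qed.

Fact tens_ract1 : tens_ract 1 = \1%VF.
Proof. by rewrite /tens_ract amulr1E tens_map_id. Qed.

Fact tens_lactM a b : tens_lact (a * b) = (tens_lact a \o tens_lact b)%VF.
Proof. by rewrite /tens_lact amull_comp tens_map_comp comp_lfun1l. Qed.

Fact tens_ractM a b : tens_ract (a * b) = (tens_ract b \o tens_ract a)%VF.
Proof. by rewrite /tens_ract amulr_comp tens_map_comp comp_lfun1l. Qed.

Fact tens_lractC a b :
  (tens_lact a \o tens_ract b = tens_ract b \o tens_lact a)%VF.
Proof.
by rewrite /tens_lact /tens_ract !tens_map_comp !comp_lfun1l !comp_lfun1r.
Qed.

(* A (x) B with the outer actions a (x (x) y) b = ax (x) yb. *)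
Definition tens_bimodule : bimodule A B :=
  Bimodule tens_lact_linear tens_ract_linear tens_lact1 tens_ract1
    tens_lactM tens_ractM tens_lractC.

End Tens.

Fact lfpost_linear (V W X : vectType k) (g : 'Hom(W, X)) :
  linear (fun f : 'Hom(V, W) => (g \o f)%VF).
Proof. by move=> c f f'; rewrite comp_lfunDr -comp_lfunZr. Qed.

Definition lfpost (V W X : vectType k) (g : 'Hom(W, X)) :
  'Hom('Hom(V, W), 'Hom(V, X)) := mklfun (lfpost_linear g).

Lemma lfpostE (V W X : vectType k) (g : 'Hom(W, X)) (f : 'Hom(V, W)) :
  lfpost V g f = (g \o f)%VF.
Proof. exact: mklfunE. Qed.

Fact lfpre_linear (V W X : vectType k) (g : 'Hom(V, W)) :
  linear (fun f : 'Hom(W, X) => (f \o g)%VF).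
Proof. by move=> c f f'; rewrite comp_lfunDl -comp_lfunZl. Qed.

Definition lfpre (V W X : vectType k) (g : 'Hom(V, W)) :
  'Hom('Hom(W, X), 'Hom(V, X)) := mklfun (lfpre_linear g).

Lemma lfpreE (V W X : vectType k) (g : 'Hom(V, W)) (f : 'Hom(W, X)) :
  lfpre X g f = (f \o g)%VF.
Proof. exact: mklfunE. Qed.

Fact lfpost_linear_in (V W X : vectType k) : linear (@lfpost V W X).
Proof.
move=> c f g; apply/lfunP=> phi; rewrite add_lfunE scale_lfunE !lfpostE.
by rewrite comp_lfunDl -comp_lfunZl.
Qed.

Lemma lfpost_comp (V W X Y : vectType k) (f : 'Hom(X, Y)) (g : 'Hom(W, X)) :
  lfpost V (f \o g) = (lfpost V f \o lfpost V g)%VF.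
Proof. by apply/lfunP=> phi; rewrite comp_lfunE !lfpostE comp_lfunA. Qed.

Lemma lfpost_id (V W : vectType k) : lfpost V \1 = \1%VF :> 'End('Hom(V, W)).
Proof. by apply/lfunP=> phi; rewrite lfpostE comp_lfun1l id_lfunE. Qed.

Section LinToTens.
Variables (A B : falgType k) (V : vectType k).
Let ltt_lact (b : B) : 'End('Hom(V, tensv A B)) :=
  lfpost V (tens_map \1 (amull b)).
Let ltt_ract (a : A) : 'End('Hom(V, tensv A B)) :=
  lfpost V (tens_map (amulr a) \1).

Fact ltt_lact_linear : linear ltt_lact.
Proof.
by move=> c a b; rewrite /ltt_lact linearP tens_mapr_linear lfpost_linear_in.
Qed.

Fact ltt_ract_linear : linear ltt_ract.
Proof.
by move=> c a b; rewrite /ltt_ract linearP tens_mapl_linear lfpost_linear_in.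
Qed.

Fact ltt_lact1 : ltt_lact 1 = \1%VF.
Proof. by rewrite /ltt_lact amull1 tens_map_id lfpost_id. Qed.

Fact ltt_ract1 : ltt_ract 1 = \1%VF.
Proof. by rewrite /ltt_ract amulr1E tens_map_id lfpost_id. Qed.

Fact ltt_lactM a b : ltt_lact (a * b) = (ltt_lact a \o ltt_lact b)%VF.
Proof.
by rewrite /ltt_lact amull_comp -lfpost_comp tens_map_comp comp_lfun1l.
Qed.

Fact ltt_ractM a b : ltt_ract (a * b) = (ltt_ract b \o ltt_ract a)%VF.
Proof.
by rewrite /ltt_ract amulr_comp -lfpost_comp tens_map_comp comp_lfun1l.
Qed.

Fact ltt_lractC b a : (ltt_lact b \o ltt_ract a = ltt_ract a \o ltt_lact b)%VF.
Proof.
rewrite /ltt_lact /ltt_ract -!lfpost_comp !tens_map_comp.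
by rewrite !comp_lfun1l !comp_lfun1r.
Qed.

(* Hom_k(V, A (x) B) with the actions induced by the inner actions
   b (x (x) y) a = xa (x) by, that is, by right multiplication in A (x) B^op. *)
Definition lin_to_tens : bimodule B A :=
  Bimodule ltt_lact_linear ltt_ract_linear ltt_lact1 ltt_ract1
    ltt_lactM ltt_ractM ltt_lractC.

End LinToTens.

End RegularDual.

Section Star.
Variables (k : fieldType) (A B : falgType k).
Implicit Types M N : bimodule A B.

Definition star_space M : {vspace 'Hom(M, tensv A B)} :=
  bim_homspace M (tens_bimodule A B).

Lemma star_spaceP M (f : 'Hom(M, tensv A B)) :
  f \in star_space M <-> @bim_hom k A B M (tens_bimodule A B) f.
Proof. exact: (@bim_homspaceP k A B M (tens_bimodule A B) f). Qed.

Lemma star_stable M : @bim_stable k B A (lin_to_tens A B M) (star_space M).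
Proof.
split=> c f /(proj1 (star_spaceP _))[fl fr]; apply/star_spaceP;
  rewrite /= lfpostE; split=> d;
  rewrite -comp_lfunA ?fl ?fr /= !comp_lfunA !tens_map_comp;
  rewrite ?comp_lfun1l ?comp_lfun1r //.
  by rewrite amullrC.
by rewrite amullrC.
Qed.

(* Hom_{A-B}(M, A (x) B), a right module over A (x) B^op, hence a
   (B, A)-bimodule. *)
Definition star M : bimodule B A := sub_bimodule (star_stable M).

Definition star_map M N (f : 'Hom(M, N)) : 'Hom(star N, star M) :=
  (linfun (vsproj (star_space M)) \o
    (lfpre (tensv A B) f \o linfun (@vsval k _ (star_space N))))%VF.

Lemma star_mapE M N (f : 'Hom(M, N)) (g : subvs_of (star_space N)) : bim_hom f ->
  vsval (star_map f g) = (vsval g \o f)%VF.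
Proof.
case=> fl fr; rewrite !comp_lfunE !lfunE /= lfpreE vsprojK //.
have /(proj1 (star_spaceP _))[gl gr] := subvsP g.
by apply/star_spaceP; split=> c; rewrite -comp_lfunA ?fl ?fr comp_lfunA ?gl ?gr
  comp_lfunA.
Qed.

Lemma star_map_hom M N (f : 'Hom(M, N)) : bim_hom f -> bim_hom (star_map f).
Proof.
move=> fh; split=> c; apply/lfunP=> g; apply/val_inj.
- rewrite (comp_lfunE (star_map f)) (comp_lfunE (lact (star M) c)) /=.
  rewrite (star_mapE _ fh) (lfsub_lact (star_stable N)) (lfsub_lact (star_stable M)).
  by rewrite (star_mapE _ fh) /= !lfpostE comp_lfunA.
- rewrite (comp_lfunE (star_map f)) (comp_lfunE (ract (star M) c)) /=.
  rewrite (star_mapE _ fh) (lfsub_ract (star_stable N)) (lfsub_ract (star_stable M)).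
  by rewrite (star_mapE _ fh) /= !lfpostE comp_lfunA.
Qed.

End Star.

Section MinimalResolutions.
Variables (k : fieldType) (A B : falgType k).
Implicit Types M N P : bimodule A B.

Definition projective P :=
  forall (X Y : bimodule A B) (g : 'Hom(X, Y)) (f : 'Hom(P, Y)),
    bim_hom g -> limg g = fullv -> bim_hom f ->
    exists h : 'Hom(P, X), bim_hom h /\ (g \o h)%VF = f.

Record bim_morphism M N := BimMorphism {
  bim_fun :> 'Hom(M, N);
  bim_funP : bim_hom bim_fun }.

Definition is_projective_cover M P (p : bim_morphism P M) :=
  [/\ projective P, limg p = fullv &
      forall U : {vspace P}, bim_stable U -> (U + lker p = fullv)%VS -> U = fullv].

(* Every f.d. bimodule has a projective cover, because A (x) B^op
   is finite dimensional: the default value (id : M -> M) is never used. *)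
Definition projective_cover M : {P : bimodule A B & bim_morphism P M} :=
  if pselect (exists c : {P : bimodule A B & bim_morphism P M},
                is_projective_cover (projT2 c)) is left h
  then projT1 (cid h) else existT _ M (BimMorphism (bim_hom_id M)).

Definition cover_obj M : bimodule A B := projT1 (projective_cover M).
Definition cover_map M : bim_morphism (cover_obj M) M :=
  projT2 (projective_cover M).

Definition syzygy M : bimodule A B :=
  sub_bimodule (bim_stable_ker (bim_funP (cover_map M))).
Definition syzygy_n (n : nat) M : bimodule A B := iter n syzygy M.

Definition res_obj M (n : nat) : bimodule A B := cover_obj (syzygy_n n M).
Definition res_diff M (n : nat) : 'Hom(res_obj M n.+1, res_obj M n) :=
  (sub_incl (bim_stable_ker (bim_funP (cover_map (syzygy_n n M)))) \o
    cover_map (syzygy_n n.+1 M))%VF.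

Lemma res_diff_hom M n : bim_hom (res_diff M n).
Proof. exact: bim_hom_comp (sub_incl_hom _) (bim_funP _). Qed.

Definition transpose M : bimodule B A :=
  quot_bimodule (bim_stable_img (star_map_hom (res_diff_hom M 0))).

Definition tau M : bimodule A B := dual_bimodule (transpose M).

(* Meaningful for n >= 1 only; the value at n = 0 is irrelevant to
   [infinite_graded]. *)
Definition tau_n (n : nat) M : bimodule A B := tau (syzygy_n n.-1 M).

End MinimalResolutions.

Section TensorTor.
Variables (k : fieldType) (L : falgType k).

Definition balancing (M : rmodule k L) (N : lmodule k L) : {vspace tensv M N} :=
  vspan (fun t => exists (m : M) (a : L) (n : N),
    t = pure_tens (ract M a m) n - pure_tens m (lact N a n)).

Definition tens_over (M : rmodule k L) (N : lmodule k L) : vectType k := quotv (balancing M N).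

Definition tens_over_map (M : rmodule k L) (N N' : lmodule k L) (f : 'Hom(N, N')) :
  'Hom(tens_over M N, tens_over M N') :=
  (quotv_pi (balancing M N') \o (tens_map \1 f \o linfun vsval))%VF.

Definition tor_diff (M : rmodule k L) (N : lmodule k L) (n : nat) :
  'Hom(tens_over M (res_obj N n.+1), tens_over M (res_obj N n)) :=
  tens_over_map M (res_diff N n).

Definition tor_cycles (M : rmodule k L) (N : lmodule k L) (n : nat) :
    {vspace tens_over M (res_obj N n)} :=
  if n is n'.+1 then lker (tor_diff M N n') else fullv.

(* Cycles modulo boundaries, modelled on a complement of the boundaries. *)
Definition Tor (M : rmodule k L) (N : lmodule k L) (n : nat) : vectType k :=
  subvs_of (tor_cycles M N n :\: limg (tor_diff M N n))%VS.

End TensorTor.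

Section Simples.
Variables (k : fieldType) (L : bound_quiver_algebra k) (x : vert (bqa_quiver L)).

Let simple_act (a : L) : 'End(k^o) := bqa_char x a *: \1%VF.
Let scalar_act (c : k^o) : 'End(k^o) := (c : k) *: \1%VF.

Fact simple_act_linear : linear simple_act.
Proof.
by move=> c a b; rewrite /simple_act bqa_char_linear scalerDl scalerA.
Qed.

Fact simple_act1 : simple_act 1 = \1%VF.
Proof. by rewrite /simple_act (bqa_char_monoid_morphism x).1 scale1r. Qed.

Fact simple_actM a b : simple_act (a * b) = (simple_act a \o simple_act b)%VF.
Proof.
rewrite /simple_act (bqa_char_monoid_morphism x).2.
by rewrite -comp_lfunZl -comp_lfunZr comp_lfun1l scalerA.
Qed.

Fact simple_actMr a b : simple_act (a * b) = (simple_act b \o simple_act a)%VF.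
Proof.
rewrite /simple_act (bqa_char_monoid_morphism x).2 mulrC.
by rewrite -comp_lfunZl -comp_lfunZr comp_lfun1l scalerA.
Qed.

Fact scalar_act_linear : linear scalar_act.
Proof. by move=> c a b; rewrite /scalar_act scalerDl -scalerA. Qed.

Fact scalar_act1 : scalar_act 1 = \1%VF.
Proof. by rewrite /scalar_act scale1r. Qed.

Fact scalar_actM a b : scalar_act (a * b) = (scalar_act a \o scalar_act b)%VF.
Proof. by rewrite /scalar_act -comp_lfunZl -comp_lfunZr comp_lfun1l scalerA. Qed.

Fact scalar_actMr a b : scalar_act (a * b) = (scalar_act b \o scalar_act a)%VF.
Proof. by rewrite mulrC scalar_actM. Qed.

Fact simple_scalarC a c :
  (simple_act a \o scalar_act c = scalar_act c \o simple_act a)%VF.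
Proof.
by rewrite -!(comp_lfunZl, comp_lfunZr) !comp_lfun1l !scalerA mulrC.
Qed.

Definition simple_left : lmodule k L :=
  Bimodule simple_act_linear scalar_act_linear simple_act1 scalar_act1
    simple_actM scalar_actMr simple_scalarC.

Definition simple_right : rmodule k L :=
  Bimodule scalar_act_linear simple_act_linear scalar_act1 simple_act1
    scalar_actM simple_actMr (fun c a => esym (simple_scalarC a c)).

End Simples.

Definition infinite_graded (k : fieldType) (V : nat -> vectType k) :=
  forall N : nat, exists n : nat, (N <= n)%N /\ exists v : V n, v != 0.

Section TauHochschild.
Variables (k : fieldType) (L : bound_quiver_algebra k).
Implicit Types x y : vert (bqa_quiver L).

(* y L x <> 0. *)
Definition path_space_neq0 y x := exists a : L, idem y * a * idem x != 0.

Definition infinite_plus_gldim := exists y x,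
  path_space_neq0 y x /\ infinite_graded (Tor (simple_right x) (simple_left y)).

Definition infinite_coplus_gldim := exists y x,
  path_space_neq0 y x /\ infinite_graded (Tor (simple_right y) (simple_left x)).

Definition nontrivial_local :=
  #|vert (bqa_quiver L)| = 1%N /\ (0 < #|arrow (bqa_quiver L)|)%N.

End TauHochschild.

Section HH.
Variables (k : fieldType) (L : falgType k).

Definition HHtau_coh (X : bimodule L L) (n : nat) : vectType k :=
  dualv (subvs_of (bim_homspace X (tau_n n (regular_bimodule L)))).

Definition HHtau_hom (X : bimodule L L) (n : nat) : vectType k :=
  subvs_of (bim_homspace (dual_bimodule X) (tau_n n (regular_bimodule L))).

End HH.

(* Main.v *)
Require Import Defs.
From mathcomp Require Import all_boot all_algebra all_field.
From mathcomp Require Import finmap monalg boolp.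

(** Write A = L, e : A -> k for the augmentation and J for its kernel. As the
    quiver has one vertex and I contains a power of the arrow ideal, J is
    nilpotent; as it has an arrow, which is not in the square of the arrow ideal,
    J is not zero. So A is local with residue field k and the socle of J contains
    some s <> 0, with a s = e(a) s = s a and e(s) = 0.

    All modules are treated at once, as bimodules over two such algebras A and B:
    one-sided modules are the case where one of them is k. Then A (x) B^op is
    local, so every bimodule has a projective cover P -> M, with kernel in the
    radical of P ([cover_exists], [cover_ker_rad]). Take s and t non zero in the
    socles of A and B. The element s (x) t annihilates the radical of every
    bimodule ([rad_bisocle]) but no non zero projective
    ([projective_not_killed]). Hence, if M <> 0 is annihilated by s (x) t, its
    cover is not injective, and the syzygy of M, which lies in the radical of the
    cover, is again non zero and annihilated by s (x) t: all the syzygies of M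
    are non zero ([syzygy_n_neq0]). This applies to the simple left module k,
    because s k = e(s) k = 0, and to the bimodule A, because s A s = k s s = 0.

    For the simple module, the terms P_n of the minimal resolution are thus non
    zero, and tensoring with the simple right module turns all the differentials
    into 0, so Tor_n(k, k) = k (x) P_n is non zero for every n ([Tor_neq0]). As
    there is only one vertex, this is both infinite + and infinite co+ global
    dimension.

    For the bimodule A, the term P_1 of the minimal presentation of its n-th
    syzygy is non zero and maps into the radical of P_0, so the transpose is non
    zero ([transpose_neq0]); therefore tau_n A <> 0 for every n >= 1. Since
    A (x) A^op is local, there is a non zero morphism between any two non zero
    bimodules, through the simple one ([bim_hom_neq0]). With source A or D A and
    target tau_n A, this says that the tau-Hochschild (co)homology of A is non
    zero in every degree n >= 1. *)

Set Implicit Arguments.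
Unset Strict Implicit.
Unset Printing Implicit Defensive.
Import GRing.Theory.
Local Open Scope ring_scope.

(** * Functionals and tensors over a field *)

Section LinearAlgebra.
Variable k : fieldType.
Implicit Types V W X : vectType k.

Lemma functional_exists V (v : V) : v != 0 -> exists phi : dualv V, phi v != 0.
Proof.
move=> v0; have vE := coord_vbasis (memvf v).
have [i ci] : exists i, coord (vbasis fullv) i v != 0.
  apply/existsP; apply: contraNT v0 => /existsPn ci0; rewrite vE big1 // => i _.
  by move/negPn/eqP: (ci0 i) => ->; rewrite scale0r.
by exists (linfun (coord (vbasis fullv) i : {linear V -> k^o})); rewrite lfunE.
Qed.

Lemma functional_separates V (U : {vspace V}) v : v \notin U ->
  exists phi : dualv V, (forall u, u \in U -> phi u = 0) /\ phi v != 0.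
Proof.
rewrite -quotv_pi_eq0 => /functional_exists[psi psiv].
exists (psi \o quotv_pi U)%VF; split; last by rewrite (comp_lfunE psi).
by move=> u; rewrite -quotv_pi_eq0 (comp_lfunE psi) => /eqP ->; rewrite linear0.
Qed.

Lemma notin_exists V (U : {vspace V}) : U <> fullv -> exists v, v \notin U.
Proof.
move=> Un; apply: contrapT => no; apply: Un; apply/eqP; rewrite eqEsubv subvf /=.
by apply/subvP=> v _; case: (boolP (v \in U)) => // vU; case: no; exists v.
Qed.

Lemma lfun_neq0 V W (f : 'Hom(V, W)) : f != 0 -> exists v, f v != 0.
Proof.
move=> f0; apply: contrapT => no; case/eqP: f0; apply/lfunP=> v.
rewrite zero_lfunE; apply/eqP; case: (boolP (f v == 0)) => // fv.
by case: no; exists v.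
Qed.

Definition dual_basis V (i : 'I_(\dim {:V})) : dualv V :=
  linfun (coord (vbasis {:V}) i : {linear V -> k^o}).

Lemma dual_basisE V (v : V) :
  v = \sum_(i < \dim {:V}) (dual_basis i v : k) *: (vbasis {:V})`_i.
Proof. by rewrite {1}(coord_vbasis (memvf v)); apply: eq_bigr => i _; rewrite lfunE. Qed.

(** The expansion of a tensor along a basis of the left factor: it makes
    [tensv], which is a space of linear maps, spanned by pure tensors. *)
Lemma tensv_sum V W (t : tensv V W) :
  t = \sum_(i < \dim {:V}) pure_tens (vbasis {:V})`_i (t (dual_basis i)).
Proof.
apply/lfunP=> phi; rewrite sum_lfunE.
under eq_bigr => i _ do rewrite pure_tensE.
have phiE : phi = \sum_(i < \dim {:V}) (phi (vbasis {:V})`_i : k) *: dual_basis i.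
  apply/lfunP=> v; rewrite {1}(dual_basisE v) linear_sum sum_lfunE.
  by apply: eq_bigr => i _; rewrite scale_lfunE linearZ /= [_ *: _]mulrC.
by rewrite {1}phiE linear_sum; apply: eq_bigr => i _; rewrite linearZ.
Qed.

Lemma tensv_ext V W X (f g : 'Hom(tensv V W, X)) :
  (forall v w, f (pure_tens v w) = g (pure_tens v w)) -> f = g.
Proof.
move=> fg; apply/lfunP=> t; rewrite (tensv_sum t) !linear_sum.
by apply: eq_bigr => i _; apply: fg.
Qed.

Lemma diffv0f V : (fullv :\: 0 = fullv :> {vspace V})%VS.
Proof.
apply/eqP; rewrite eqEdim diffvSl.
by have := dimv_cap_compl (@fullv k V) 0; rewrite capv0 dimv0 add0n => ->; rewrite leqnn.
Qed.

Lemma surj_preimage V W (f : 'Hom(V, W)) w : limg f = fullv -> exists v, f v = w.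
Proof. by move=> fs; have := memvf w; rewrite -fs => /memv_imgP[v _ ->]; exists v. Qed.

End LinearAlgebra.

(** * Augmented local algebras *)

(** A local algebra with residue field k, presented by the augmentation
    A -> k whose kernel is the nilpotent radical. Nilpotency is stated with
    products of sequences, which is the form in which it acts on modules. *)
Record local_aug (k : fieldType) (A : falgType k) := LocalAug {
  aug :> A -> k;
  aug_linear : linear_for *%R aug;
  aug_morph : monoid_morphism aug;
  aug_nil : exists n, forall s : seq A, size s = n ->
    (forall a, a \in s -> aug a = 0) -> \prod_(a <- s) a = 0 }.

Section AugmentationTheory.
Variables (k : fieldType) (A : falgType k) (e : local_aug A).

Lemma aug1 : e 1 = 1. Proof. exact: (aug_morph e).1. Qed.
Lemma augM a b : e (a * b) = e a * e b. Proof. exact: (aug_morph e).2. Qed.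
Lemma aug0 : e 0 = 0.
Proof. by have := aug_linear e (-1) 0 0; rewrite scaler0 addr0 mulN1r addNr. Qed.
Lemma augD a b : e (a + b) = e a + e b.
Proof. by have := aug_linear e 1 a b; rewrite scale1r mul1r. Qed.
Lemma augZ c a : e (c *: a) = c * e a.
Proof. by have := aug_linear e c a 0; rewrite !addr0 aug0 addr0. Qed.
Lemma augB1 a : e (a - e a *: 1) = 0.
Proof. by rewrite -scaleNr augD augZ aug1 mulr1 subrr. Qed.

(** Apply elements of the augmentation ideal as long as the result is non zero:
    nilpotency bounds the number of steps, and the last non zero vector is
    annihilated by the ideal. The property Q records what the steps preserve, so
    that the left and the right action can be treated one after the other. *)
Lemma nilpotent_fixed_point (X : zmodType) (act : A -> X -> X) (Q : X -> Prop) x :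
    (exists n, forall s y, size s = n -> (forall a, a \in s -> e a = 0) ->
       foldr act y s = 0) ->
    (forall a y, e a = 0 -> Q y -> Q (act a y)) -> Q x -> x != 0 ->
  exists y, [/\ Q y, y != 0 & forall a, e a = 0 -> act a y = 0].
Proof.
case=> n nilA Qact; have {nilA} : forall s, size s = n ->
  (forall a, a \in s -> e a = 0) -> foldr act x s = 0 by move=> s; apply: nilA.
elim: n x => [|n IH] x nilx Qx x0; first by case/eqP: x0; apply: (nilx [::]).
have [[a [ea ax0]]|nex] := pselect (exists a, e a = 0 /\ act a x != 0).
  apply: (IH (act a x)) => //; last exact: Qact.
  move=> s sn es; rewrite -foldr_rcons; apply: nilx; first by rewrite size_rcons sn.
  by move=> b; rewrite mem_rcons inE => /predU1P[->|/es].
exists x; split=> // a ea; apply/eqP; case: eqP => // /eqP ax.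
by case: nex; exists a.
Qed.

End AugmentationTheory.

(** * Bimodules over a pair of augmented local algebras *)

Section Local.
Variables (k : fieldType) (A B : falgType k).
Variables (eA : local_aug A) (eB : local_aug B).
Implicit Types M N P X Y : bimodule A B.

Lemma lactMl M a a' v : lact M (a * a') v = lact M a (lact M a' v).
Proof. by rewrite lactM (comp_lfunE (lact M a)). Qed.
Lemma ractMl M b b' v : ract M (b * b') v = ract M b' (ract M b v).
Proof. by rewrite ractM (comp_lfunE (ract M b')). Qed.
Lemma lact1v M v : lact M 1 v = v. Proof. by rewrite lact1 id_lfunE. Qed.
Lemma ract1v M v : ract M 1 v = v. Proof. by rewrite ract1 id_lfunE. Qed.
Lemma lractCv M a b v : lact M a (ract M b v) = ract M b (lact M a v).
Proof.
by rewrite -(comp_lfunE (lact M a)) lractC (comp_lfunE (ract M b)).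
Qed.
Lemma lactP M c a a' v : lact M (c *: a + a') v = c *: lact M a v + lact M a' v.
Proof. by rewrite lact_linear add_lfunE scale_lfunE. Qed.
Lemma ractP M c a a' v : ract M (c *: a + a') v = c *: ract M a v + ract M a' v.
Proof. by rewrite ract_linear add_lfunE scale_lfunE. Qed.
Lemma lact0v M v : lact M 0 v = 0.
Proof. by have := lactP (-1) 0 0 v; rewrite scaler0 addr0 scaleN1r addNr. Qed.
Lemma ract0v M v : ract M 0 v = 0.
Proof. by have := ractP (-1) 0 0 v; rewrite scaler0 addr0 scaleN1r addNr. Qed.
Lemma lactZ M c a v : lact M (c *: a) v = c *: lact M a v.
Proof. by rewrite -[c *: a]addr0 lactP lact0v addr0. Qed.
Lemma ractZ M c b v : ract M (c *: b) v = c *: ract M b v.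
Proof. by rewrite -[c *: b]addr0 ractP ract0v addr0. Qed.
Lemma lactB1 M a v : lact M (a - eA a *: 1) v = lact M a v - eA a *: v.
Proof. by rewrite -scaleNr addrC lactP lact1v addrC scaleNr. Qed.
Lemma ractB1 M a v : ract M (a - eB a *: 1) v = ract M a v - eB a *: v.
Proof. by rewrite -scaleNr addrC ractP ract1v addrC scaleNr. Qed.

Lemma bim_homP M N (f : 'Hom(M, N)) : bim_hom f <->
  (forall a v, f (lact M a v) = lact N a (f v)) /\
  (forall b v, f (ract M b v) = ract N b (f v)).
Proof.
split=> [[fl fr]|[fl fr]]; split=> c.
- by move=> v; have /lfunP/(_ v) := fl c; rewrite (comp_lfunE f) (comp_lfunE (lact N c)).
- by move=> v; have /lfunP/(_ v) := fr c; rewrite (comp_lfunE f) (comp_lfunE (ract N c)).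
- by apply/lfunP=> v; rewrite (comp_lfunE f) (comp_lfunE (lact N c)) fl.
- by apply/lfunP=> v; rewrite (comp_lfunE f) (comp_lfunE (ract N c)) fr.
Qed.

Let triv_act (C : falgType k) (e : local_aug C) (c : C) : 'End(k^o) := e c *: \1%VF.

Fact triv_act_linear C (e : local_aug C) : linear (triv_act e).
Proof. by move=> c a b; rewrite /triv_act aug_linear scalerDl scalerA. Qed.
Fact triv_act1 C (e : local_aug C) : triv_act e 1 = \1%VF.
Proof. by rewrite /triv_act aug1 scale1r. Qed.
Fact triv_actC C C' (e : local_aug C) (e' : local_aug C') a b :
  (triv_act e a \o triv_act e' b = triv_act e' b \o triv_act e a)%VF.
Proof.
by rewrite /triv_act -!(comp_lfunZl, comp_lfunZr) !comp_lfun1l !scalerA mulrC.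
Qed.
Fact triv_actM C (e : local_aug C) a b :
  triv_act e (a * b) = (triv_act e a \o triv_act e b)%VF.
Proof.
by rewrite /triv_act augM -comp_lfunZl -comp_lfunZr comp_lfun1l scalerA.
Qed.
Fact triv_actMr C (e : local_aug C) a b :
  triv_act e (a * b) = (triv_act e b \o triv_act e a)%VF.
Proof. by rewrite triv_actC triv_actM. Qed.

Definition triv_bimodule : bimodule A B :=
  Bimodule (triv_act_linear eA) (triv_act_linear eB) (triv_act1 eA) (triv_act1 eB)
    (triv_actM eA) (triv_actMr eB) (triv_actC eA eB).

(** The simple (A, B)-bimodule is k with both augmentations; bimodule morphisms
    to it are the linear forms on the top of M. They are spelled out pointwise
    because they serve as the only access to the top and to the radical. *)
Definition character M (phi : dualv M) :=
  (forall a v, phi (lact M a v) = eA a * phi v) /\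
  (forall b v, phi (ract M b v) = eB b * phi v).

Lemma character_hom M (phi : dualv M) :
  character phi <-> @bim_hom k A B M triv_bimodule phi.
Proof.
by split=> [[pl pr]|/bim_homP[pl pr]]; [apply/bim_homP|]; split=> c v;
  rewrite ?pl ?pr /= scale_lfunE id_lfunE.
Qed.

(** Every a splits as e(a) 1 plus an element of the augmentation ideal, so only the
    action of the two ideals has to be tested. *)
Lemma characterP M (phi : dualv M) :
  (forall a v, eA a = 0 -> phi (lact M a v) = 0) ->
  (forall b v, eB b = 0 -> phi (ract M b v) = 0) -> character phi.
Proof.
move=> pl pr; split=> c v.
  by have := pl _ v (augB1 eA c); rewrite lactB1 linearB linearZ => /subr0_eq.
by have := pr _ v (augB1 eB c); rewrite ractB1 linearB linearZ => /subr0_eq.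
Qed.

Lemma foldr_lact_nil M : exists n, forall s (u : M), size s = n ->
  (forall a, a \in s -> eA a = 0) -> foldr (fun a => lact M a) u s = 0.
Proof.
case: (aug_nil eA) => n nilA; exists n => s u sn es.
have -> : foldr (fun a => lact M a) u s = lact M (\prod_(a <- s) a) u.
  elim: {sn es} s => [|b s IH] /=; first by rewrite big_nil lact1v.
  by rewrite big_cons lactMl IH.
by rewrite nilA // lact0v.
Qed.

Lemma foldr_ract_nil M : exists n, forall s (u : M), size s = n ->
  (forall a, a \in s -> eB a = 0) -> foldr (fun a => ract M a) u s = 0.
Proof.
case: (aug_nil eB) => n nilA; exists n => s u sn es.
have -> : foldr (fun a => ract M a) u s = ract M (\prod_(a <- rev s) a) u.
  elim: {sn es} s => [|b s IH] /=; first by rewrite big_nil ract1v.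
  by rewrite rev_cons -cats1 big_cat big_seq1 ractMl IH.
by rewrite nilA ?ract0v ?size_rev // => b; rewrite mem_rev; apply: es.
Qed.

(** The two augmentation ideals act nilpotently and their actions commute: reach
    first a vector killed by the left one, then, without losing this, a vector
    killed by the right one as well. *)
Lemma socle_exists M (U : {vspace M}) u : bim_stable U -> u \in U -> u != 0 ->
  exists y, [/\ y \in U, y != 0, forall a, lact M a y = eA a *: y &
                 forall b, ract M b y = eB b *: y].
Proof.
case=> Ul Ur uU u0.
have [y [yU y0 yl]] := nilpotent_fixed_point (foldr_lact_nil M)
  (fun a y _ => Ul a y) uU u0.
have [z [[zU zl] z0 zr]] : exists z, [/\ z \in U /\
    (forall a, eA a = 0 -> lact M a z = 0), z != 0 &
    forall b, eB b = 0 -> ract M b z = 0].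
  apply: (nilpotent_fixed_point (foldr_ract_nil M) _ _ y0) => // b x _ [xU xl].
  by split=> [|a ea]; [apply: Ur|rewrite lractCv xl ?linear0].
exists z; split=> // c; apply/subr0_eq.
  by rewrite -lactB1 zl ?augB1.
by rewrite -ractB1 zr ?augB1.
Qed.

End Local.

(** * The radical of a bimodule *)

Section Radical.
Variables (k : fieldType) (A B : falgType k).
Variables (eA : local_aug A) (eB : local_aug B).
Implicit Types M N P X Y : bimodule A B.
Local Notation character := (character eA eB).

(** Dually to the existence of a socle: the annihilator of U in D(M) is a non
    zero sub-bimodule, and a form in its socle is a bimodule morphism M -> k. *)
Lemma stable_character M (U : {vspace M}) : bim_stable U -> U <> fullv ->
  exists phi : dualv M,
    [/\ phi != 0, forall u, u \in U -> phi u = 0 & character phi].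
Proof.
case=> Ul Ur /notin_exists[v vU].
have [psi [psiU psiv]] := functional_separates vU.
have [|c f g fU gU u uU|V VP] := @vspace_exists k (dual_bimodule M)
    (fun phi : dualv M => forall u, u \in U -> phi u = 0).
- by move=> u _; rewrite zero_lfunE.
- by rewrite add_lfunE scale_lfunE fU // gU // scaler0 addr0.
have [|||phi [/VP phiU phi0 phir phil]] :=
    @socle_exists k B A eB eA (dual_bimodule M) V psi.
- by split=> c phi /VP phiU; apply/VP=> u uU; rewrite /= lfdualE comp_lfunE phiU // ?Ul ?Ur.
- exact/VP.
- by apply: contraNneq psiv => ->; rewrite zero_lfunE.
exists phi; split=> //; split=> c w.
  by have /lfunP/(_ w) := phil c; rewrite /= lfdualE comp_lfunE scale_lfunE.
by have /lfunP/(_ w) := phir c; rewrite /= lfdualE comp_lfunE scale_lfunE.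
Qed.

Lemma character_exists M (v : M) : v != 0 ->
  exists phi : dualv M, phi != 0 /\ character phi.
Proof.
move=> v0; have [||phi [phi0 _ phic]] := @stable_character M 0%VS.
- by split=> c u; rewrite !memv0 => /eqP ->; rewrite linear0.
- by move=> E; case/eqP: v0; apply/eqP; rewrite -memv0 E memvf.
by exists phi.
Qed.

(** The radical, as the common kernel of all morphisms to the simple bimodule.
    This equals J M + M J' for the augmentation ideals J and J', and spares the
    handling of generators of that sum. *)
Definition in_rad M (v : M) := forall phi : dualv M, character phi -> phi v = 0.

Lemma rad_vspace_exists M : exists U : {vspace M}, forall v, v \in U <-> in_rad v.
Proof.
apply: vspace_exists => [phi _|c u v Ru Rv phi phic]; first exact: linear0.
by rewrite linearP /= Ru // Rv // scaler0 addr0.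
Qed.

Lemma character_comp M N (f : 'Hom(M, N)) (phi : dualv N) :
  bim_hom f -> character phi -> character (phi \o f)%VF.
Proof.
move=> /bim_homP[fl fr] [pl pr].
by split=> c v; rewrite !(comp_lfunE phi) ?fl ?fr ?pl ?pr.
Qed.

(** If U is proper, some non zero character vanishes on U; it vanishes on the
    radical too, hence everywhere. *)
Lemma nakayama M (U : {vspace M}) : bim_stable U ->
  (forall v, exists2 u, u \in U & in_rad (v - u)) -> U = fullv.
Proof.
move=> Us URad; apply: contrapT => /(stable_character Us)[phi [phi0 phiU phic]].
case/eqP: phi0; apply/lfunP=> v; have [u uU /(_ _ phic)] := URad v.
by rewrite linearB => /subr0_eq /= ->; rewrite phiU // zero_lfunE.
Qed.

(** For any linear form psi, the form v |-> psi(s v t) is a character because s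
    and t lie in the socles; so it vanishes on the radical. *)
Lemma rad_bisocle M s t (v : M) : (forall a, s * a = eA a *: s) ->
  (forall b, b * t = eB b *: t) -> in_rad v -> lact M s (ract M t v) = 0.
Proof.
move=> sl tr vr; apply/eqP; case: eqP => // /eqP/functional_exists[psi].
pose f : dualv M := (psi \o (lact M s \o ract M t))%VF.
have fE w : f w = psi (lact M s (ract M t w)).
  by rewrite /f (comp_lfunE psi) (comp_lfunE (lact M s)).
rewrite -fE vr ?eqxx //; split=> c w; rewrite !fE.
  by rewrite -lractCv -lactMl sl lactZ linearZ.
by rewrite -ractMl tr ractZ !linearZ.
Qed.

End Radical.

(** * Free bimodules *)

Section FreeBimodules.
Variables (k : fieldType) (A B : falgType k).
Implicit Types M N P X Y : bimodule A B.
Local Notation tens := (tens_bimodule A B).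

Definition tens_unit : tens := pure_tens (1 : A) (1 : B).

Lemma tens_lactE a x b : lact tens a (pure_tens x b) = pure_tens (a * x) b.
Proof. by rewrite /= tens_map_pure !lfunE. Qed.
Lemma tens_ractE a x b : ract tens b (pure_tens a x) = pure_tens a (x * b).
Proof. by rewrite /= tens_map_pure !lfunE. Qed.

Fact tens_lift_linear Y (y : Y) : linear (fun t : tensv A B =>
  \sum_(i < \dim {:A}) lact Y (vbasis {:A})`_i (ract Y (t (dual_basis i)) y)).
Proof.
move=> c s t; rewrite scaler_sumr -big_split; apply: eq_bigr => i _ /=.
by rewrite add_lfunE scale_lfunE ractP linearP.
Qed.
Definition tens_lift Y (y : Y) : 'Hom(tens, Y) := mklfun (tens_lift_linear y).

Lemma tens_lift_pure Y (y : Y) a b :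
  tens_lift y (pure_tens a b) = lact Y a (ract Y b y).
Proof.
rewrite [LHS]mklfunE {2}(dual_basisE a).
rewrite (big_morph (fun a => lact Y a (ract Y b y)) (id1 := 0) (op1 := +%R)); last exact: lact0v.
  apply: eq_bigr => i _; rewrite pure_tensE.
  by rewrite ractZ lactZ linearZ.
by move=> x z; rewrite -{1}[x]scale1r lactP scale1r.
Qed.

Lemma tens_lift_unit Y (y : Y) : tens_lift y tens_unit = y.
Proof. by rewrite tens_lift_pure lact1v ract1v. Qed.

Lemma tens_lift_hom Y (y : Y) : bim_hom (tens_lift y).
Proof.
split=> c; apply: tensv_ext => a b.
  rewrite (comp_lfunE (tens_lift y)) (comp_lfunE (lact Y c)) tens_lactE.
  by rewrite !tens_lift_pure lactMl.
rewrite (comp_lfunE (tens_lift y)) (comp_lfunE (ract Y c)) tens_ractE.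
by rewrite !tens_lift_pure ractMl lractCv.
Qed.

Lemma tens_homE Y (f : 'Hom(tens, Y)) : bim_hom f -> f = tens_lift (f tens_unit).
Proof.
move=> /bim_homP[fl fr]; apply: tensv_ext => a b; rewrite tens_lift_pure -fr -fl.
by rewrite tens_ractE mul1r tens_lactE mulr1.
Qed.

Variable n : nat.
Definition free_space : vectType k := {ffun 'I_n -> tens}.

Fact ffun_act_linear (f : 'End(tens)) :
  linear (fun v : free_space => [ffun i => f (v i)] : free_space).
Proof. by move=> c u v; apply/ffunP=> i; rewrite !ffunE linearP. Qed.
Let ffun_act (f : 'End(tens)) : 'End(free_space) := mklfun (ffun_act_linear f).
Let ffun_actE f (v : free_space) i : ffun_act f v i = f (v i).
Proof. by rewrite /ffun_act mklfunE ffunE. Qed.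
Let ffun_act_comp f g : ffun_act (f \o g)%VF = (ffun_act f \o ffun_act g)%VF.
Proof.
by apply/lfunP=> v; apply/ffunP=> i; rewrite (comp_lfunE (ffun_act f)) !ffun_actE (comp_lfunE f).
Qed.
Fact ffun_act_linear_in (C : falgType k) (act : C -> 'End(tens)) : linear act ->
  linear (fun c => ffun_act (act c)).
Proof.
move=> al c a b; apply/lfunP=> v; apply/ffunP=> i.
by rewrite add_lfunE scale_lfunE !ffunE !ffun_actE al add_lfunE scale_lfunE.
Qed.
Fact ffun_act1 (f : 'End(tens)) : f = \1%VF -> ffun_act f = \1%VF.
Proof. by move=> ->; apply/lfunP=> v; apply/ffunP=> i; rewrite ffun_actE !id_lfunE. Qed.
Fact free_lactM a b : ffun_act (lact tens (a * b)) =
  (ffun_act (lact tens a) \o ffun_act (lact tens b))%VF.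
Proof. by rewrite lactM ffun_act_comp. Qed.
Fact free_ractM a b : ffun_act (ract tens (a * b)) =
  (ffun_act (ract tens b) \o ffun_act (ract tens a))%VF.
Proof. by rewrite ractM ffun_act_comp. Qed.
Fact free_lractC a b : (ffun_act (lact tens a) \o ffun_act (ract tens b) =
  ffun_act (ract tens b) \o ffun_act (lact tens a))%VF.
Proof. by rewrite -!ffun_act_comp lractC. Qed.

Definition free_bimodule : bimodule A B :=
  Bimodule (ffun_act_linear_in (@lact_linear _ _ _ tens))
    (ffun_act_linear_in (@ract_linear _ _ _ tens))
    (ffun_act1 (@lact1 _ _ _ tens)) (ffun_act1 (@ract1 _ _ _ tens))
    free_lactM free_ractM free_lractC.

Fact free_inj_linear (i : 'I_n) :
  linear (fun t : tens => [ffun j => if j == i then t else 0] : free_space).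
Proof.
by move=> c u v; apply/ffunP=> j; rewrite !ffunE; case: eqP; rewrite ?scaler0 ?addr0.
Qed.
Definition free_inj i : 'Hom(tens, free_bimodule) := mklfun (free_inj_linear i).
Lemma free_injE i t j : free_inj i t j = if j == i then t else 0.
Proof. by rewrite [free_inj i t]mklfunE ffunE. Qed.
Lemma free_inj_hom i : bim_hom (free_inj i).
Proof.
by apply/bim_homP; split=> c v; apply/ffunP=> j;
  rewrite [in RHS]ffun_actE !free_injE; case: eqP; rewrite ?linear0.
Qed.
Lemma free_sum (v : free_bimodule) : v = \sum_i free_inj i (v i).
Proof.
apply/ffunP=> j; rewrite sum_ffunE (bigD1 j) //= big1 ?addr0 ?free_injE ?eqxx //.
by move=> i ij; rewrite free_injE eq_sym (negPf ij).
Qed.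

Definition free_gen i : free_bimodule := free_inj i tens_unit.

Fact free_lift_linear Y (y : 'I_n -> Y) :
  linear (fun v : free_bimodule => \sum_i tens_lift (y i) (v i)).
Proof.
move=> c u v; rewrite scaler_sumr -big_split; apply: eq_bigr => i _ /=.
by rewrite !ffunE linearP.
Qed.
Definition free_lift Y (y : 'I_n -> Y) : 'Hom(free_bimodule, Y) := mklfun (free_lift_linear y).

Lemma free_liftE Y (y : 'I_n -> Y) v :
  free_lift y v = \sum_i tens_lift (y i) (v i).
Proof. exact: mklfunE. Qed.

Lemma free_lift_hom Y (y : 'I_n -> Y) : bim_hom (free_lift y).
Proof.
apply/bim_homP; split=> c v; rewrite !free_liftE linear_sum; apply: eq_bigr => i _;
  have /bim_homP[yl yr] := tens_lift_hom (y i).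
- by rewrite -[RHS]yl; congr (tens_lift _ _); apply: ffun_actE.
- by rewrite -[RHS]yr; congr (tens_lift _ _); apply: ffun_actE.
Qed.

Lemma free_homE Y (f : 'Hom(free_bimodule, Y)) :
  bim_hom f -> f = free_lift (fun i => f (free_gen i)).
Proof.
move=> fh; apply/lfunP=> v; rewrite {1}(free_sum v) linear_sum free_liftE.
apply: eq_bigr => i _; have /lfunP/(_ (v i)) := tens_homE (bim_hom_comp fh (free_inj_hom i)).
by rewrite !(comp_lfunE f).
Qed.

Lemma free_lift_gen Y (y : 'I_n -> Y) i : free_lift y (free_gen i) = y i.
Proof.
rewrite free_liftE (bigD1 i) //= big1 ?addr0 => [|j ji]; last first.
  by rewrite free_injE (negPf ji) linear0.
by rewrite free_injE eqxx tens_lift_unit.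
Qed.

(** A morphism out of a free bimodule amounts to a choice of images of the
    generators, and these can be lifted along a surjection. *)
Lemma free_projective : projective free_bimodule.
Proof.
move=> X Y g f gh gs fh.
have /choice[x xE] : forall i, exists x, g x = f (free_gen i) by move=> i; apply: surj_preimage.
exists (free_lift x); split; first exact: free_lift_hom.
rewrite (free_homE (bim_hom_comp gh (free_lift_hom x))) [RHS](free_homE fh).
by congr free_lift; apply/funext=> i; rewrite (comp_lfunE g) free_lift_gen.
Qed.

End FreeBimodules.

(** * Projective covers, syzygies and transposes *)

Section ProjectiveCovers.
Variables (k : fieldType) (A B : falgType k).
Variables (eA : local_aug A) (eB : local_aug B).
Implicit Types M N P X Y : bimodule A B.
Local Notation tens := (tens_bimodule A B).
Local Notation triv := (triv_bimodule eA eB).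
Local Notation character := (character eA eB).
Local Notation in_rad := (in_rad eA eB).

Definition tens_aug : dualv tens := @tens_lift k A B triv (1 : k).

Lemma tens_aug_character : character tens_aug.
Proof. by apply/character_hom; apply: tens_lift_hom. Qed.

Lemma tens_aug_unit : tens_aug (tens_unit A B) = 1.
Proof. exact: (@tens_lift_unit k A B triv). Qed.

(** A (x) B^op has a simple top, so all characters are multiples of one. *)
Lemma tens_character (phi : dualv tens) t :
  character phi -> phi t = phi (tens_unit A B) * tens_aug t.
Proof.
move=> [pl pr]; have [ql qr] := tens_aug_character.
suff E : phi = (phi (tens_unit A B) : k) *: tens_aug by rewrite {1}E scale_lfunE.
apply: tensv_ext => a b; rewrite scale_lfunE.
have -> : pure_tens a b = lact tens a (ract tens b (tens_unit A B)).
  by rewrite tens_ractE mul1r tens_lactE mulr1.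
by rewrite pl pr ql qr tens_aug_unit mulr1 [RHS]mulrC -mulrA.
Qed.

Lemma free_character n (phi : dualv (free_bimodule A B n)) v : character phi ->
  phi v = \sum_i phi (free_gen A B i) * tens_aug (v i).
Proof.
move=> phic; rewrite {1}(free_sum v) linear_sum; apply: eq_bigr => i _.
have /(tens_character (v i)) := character_comp (free_inj_hom A B i) phic.
by rewrite !(comp_lfunE phi).
Qed.

(** When the images of the generators are linearly independent modulo the
    radical of M, an element of the kernel has all its components in the
    radical: testing with characters of M gives a relation between the images
    whose coefficients are the augmentations of the components. *)
Lemma free_ker_rad n M (y : 'I_n -> M) v :
    (forall c : 'I_n -> k, in_rad (\sum_i c i *: y i) -> forall i, c i = 0) ->
  free_lift y v = 0 -> in_rad v.
Proof.
move=> yfree v0.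
have caug i : tens_aug (v i) = 0.
  apply: (yfree (fun i => tens_aug (v i))) => phi phic.
  have := free_character v (character_comp (free_lift_hom y) phic).
  rewrite (comp_lfunE phi) v0 linear0 => /esym E; rewrite linear_sum -[RHS]E.
  by apply: eq_bigr => j _; rewrite linearZ (comp_lfunE phi) free_lift_gen [RHS]mulrC.
move=> phi phic; rewrite free_character //.
by rewrite big1 // => i _; rewrite caug mulr0.
Qed.

(** Map the generators of a free bimodule to a basis of a complement of the
    radical. Nakayama's lemma gives surjectivity, and the kernel is small
    because it lies in the radical. *)
Lemma cover_exists M :
  exists c : {P : bimodule A B & bim_morphism P M}, is_projective_cover (projT2 c).
Proof.
have [R RP] := rad_vspace_exists eA eB M; pose W := (R^C)%VS.
pose y (i : 'I_(\dim W)) : M := (vbasis W)`_i.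
exists (existT _ (free_bimodule A B (\dim W)) (BimMorphism (free_lift_hom y))).
split=> /=; first exact: free_projective.
  apply: nakayama (bim_stable_img (free_lift_hom y)) _ => v.
  have : v \in (R + W)%VS by rewrite addv_complf memvf.
  case/memv_addP=> r rR [w wW ->]; exists w; last by rewrite addrK; apply/RP.
  rewrite (coord_vbasis wW); apply: rpred_sum => i _; apply: rpredZ.
  by rewrite -[_`_i](free_lift_gen y i) memv_img ?memvf.
move=> U Us UK; apply: (nakayama Us) => v.
have : v \in (U + lker (free_lift y))%VS by rewrite UK memvf.
case/memv_addP=> u uU [w wK ->]; exists u => //; rewrite addrC addKr.
apply: (@free_ker_rad _ _ y); last by apply/eqP; rewrite -memv_ker.
move=> c /RP cR; have : \sum_i c i *: y i \in (R :&: W)%VS.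
  rewrite memv_cap cR; apply: rpred_sum => i _; apply: rpredZ.
  by apply/vbasis_mem/mem_nth; rewrite size_tuple.
rewrite capv_compl memv0 => /eqP E i.
by have /freeP/(_ _ E i) := basis_free (vbasisP W).
Qed.

Lemma cover_mapP M : is_projective_cover (cover_map M).
Proof.
rewrite /cover_map /cover_obj /projective_cover.
by case: pselect => [h|/(_ (cover_exists M))[]]; case: cid.
Qed.

(** Minimality: were some character of P non zero at a vector of the kernel, its
    own kernel would be a proper sub-bimodule that generates P together with
    the kernel of the cover. *)
Lemma cover_ker_rad M P (p : bim_morphism P M) v :
  is_projective_cover p -> p v = 0 -> in_rad v.
Proof.
case=> _ _ small pv phi phic; apply/eqP; case: eqP => // /eqP pv0.
have UT : lker phi = fullv.
  apply: small; first by apply: (bim_stable_ker (N := triv)); apply/character_hom.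
  apply/eqP; rewrite eqEsubv subvf; apply/subvP=> w _.
  rewrite -[w](subrK ((phi w / phi v) *: v)); apply: memv_add.
    by rewrite memv_ker linearB linearZ subr_eq0; apply/eqP; rewrite /= -[RHS]/(_ * _) divfK.
  by rewrite memv_ker linearZ /= pv scaler0.
by have := memvf v; rewrite -UT memv_ker (negPf pv0).
Qed.

(** A non zero character of P lifts along the augmentation of A (x) B^op. *)
Lemma projective_to_tens P (p : P) : projective P -> p != 0 ->
  exists h : 'Hom(P, tens), bim_hom h /\ exists v, tens_aug (h v) != 0.
Proof.
move=> Pproj /(character_exists eA eB)[phi [phi0 phic]].
have augs : limg tens_aug = fullv.
  apply/eqP; rewrite eqEsubv subvf; apply/subvP=> c _; apply/memv_imgP.
  exists ((c : k) *: tens_unit A B); first exact: memvf.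
  by rewrite linearZ /= tens_aug_unit [RHS]mulr1.
have [h [hh hE]] := Pproj tens triv tens_aug phi
  (proj1 (character_hom _ _ _) tens_aug_character) augs (proj1 (character_hom _ _ _) phic).
exists h; split=> //; have [v pv] := lfun_neq0 phi0.
by exists v; rewrite -(comp_lfunE tens_aug) hE.
Qed.

Section Socle.
Variables (s : A) (t : B).
Hypotheses (s0 : s != 0) (t0 : t != 0).
Hypotheses (sl : forall a, s * a = eA a *: s) (tr : forall b, b * t = eB b *: t).

(** Annihilation by s (x) t is what obstructs projectivity: s (x) t is a non zero
    element of the socle of A (x) B^op, so it annihilates every radical but no
    non zero projective. *)
Definition killed M := forall v : M, lact M s (ract M t v) = 0.

Lemma pure_tens_neq0 : pure_tens s t != 0.
Proof.
have [phi ps] := functional_exists s0; apply: contraNneq t0 => /lfunP/(_ phi).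
by rewrite pure_tensE zero_lfunE => /eqP; rewrite scaler_eq0 (negPf ps).
Qed.

(** A morphism h : P -> A (x) B^op that hits a unit c + (radical) satisfies
    h(s v t) = c (s (x) t) for the corresponding v. *)
Lemma projective_not_killed P (p : P) : projective P -> p != 0 -> ~ killed P.
Proof.
move=> Pproj p0 Pk; have [h [/bim_homP[hl hr] [v hv]]] := projective_to_tens Pproj p0.
have := congr1 h (Pk v); rewrite hl hr linear0.
set c := tens_aug (h v) in hv; pose u := tens_unit A B.
have : in_rad (h v - (c : k) *: u).
  move=> phi phic; rewrite linearB linearZ /= tens_character // [_ *: _]mulrC.
  exact: subrr.
have uE : lact tens s (ract tens t ((c : k) *: u)) = (c : k) *: pure_tens s t.
  by rewrite !linearZ /= !tens_map_pure !lfunE /= mul1r mulr1.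
move=> /(rad_bisocle sl tr) huv hv0.
have : (c : k) *: pure_tens s t = 0.
  by rewrite -uE -[RHS]hv0; move: huv; rewrite 2!linearB => /subr0_eq/esym.
by move/eqP; rewrite scaler_eq0 (negPf hv) (negPf pure_tens_neq0).
Qed.

(** Syzygies in a minimal resolution lie in the radical of a projective. *)
Lemma syzygy_killed M : killed (syzygy M).
Proof.
have Ks := bim_stable_ker (bim_funP (cover_map M)).
move=> w; apply/val_inj; rewrite /= (lfsub_lact Ks) (lfsub_ract Ks).
apply: (rad_bisocle sl tr); apply: (cover_ker_rad (cover_mapP M)).
by apply/eqP; rewrite -memv_ker; apply: subvsP.
Qed.

(** M is killed by s (x) t but its projective cover is not, so the cover is not
    injective. *)
Lemma syzygy_neq0 M (m : M) : killed M -> m != 0 -> exists w : syzygy M, w != 0.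
Proof.
move=> Mk m0; have [Pproj ps _] := cover_mapP M.
have [p pm] := surj_preimage m ps.
have p0 : p != 0 by apply: contraNneq m0 => p0; rewrite -pm p0 linear0.
have [v sv] : exists v, lact (cover_obj M) s (ract _ t v) != 0.
  apply: contrapT => no; apply: (projective_not_killed Pproj p0) => v.
  by apply/eqP; case: eqP => // /eqP sv; case: no; exists v.
have vK : lact (cover_obj M) s (ract _ t v) \in lker (cover_map M).
  by have /bim_homP[fl fr] := bim_funP (cover_map M); rewrite memv_ker fl fr Mk.
exists (Subvs vK); apply: contraNneq sv => /(congr1 val) /= ->; exact: eqxx.
Qed.

Lemma syzygy_n_neq0 M (m : M) n : killed M -> m != 0 ->
  killed (syzygy_n n M) /\ exists w : syzygy_n n M, w != 0.
Proof.
move=> Mk m0; elim: n => [|n [IHk [w w0]]]; first by split=> //; exists m.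
by split; [apply: syzygy_killed|apply: syzygy_neq0 IHk w0].
Qed.

End Socle.

(** The image of a differential is a syzygy, contained in the radical of the
    projective below. *)
Lemma res_diff_rad M n v : in_rad (res_diff M n v).
Proof.
apply: (cover_ker_rad (cover_mapP (syzygy_n n M))).
rewrite /res_diff (comp_lfunE (sub_incl _)) /sub_incl lfunE.
by apply/eqP; rewrite -memv_ker; apply: subvsP.
Qed.

Lemma cover_neq0 M (m : M) : m != 0 -> exists p : cover_obj M, p != 0.
Proof.
move=> m0; have [_ ps _] := cover_mapP M; have [p pm] := surj_preimage m ps.
by exists p; apply: contraNneq m0 => p0; rewrite -pm p0 linear0.
Qed.

(** The transpose is the cokernel of f |-> f d on Hom(-, A (x) B^op). As the
    image of d lies in the radical, every f d has its values in the radical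
    of A (x) B^op, whereas some morphism from the non zero projective P_1 does
    not: the map is not surjective. *)
Lemma transpose_neq0 M (w : syzygy M) : w != 0 -> exists z : transpose M, z != 0.
Proof.
case/cover_neq0=> p p0; have [Pproj _ _] := cover_mapP (syzygy M).
have [h [hh [v hv]]] := projective_to_tens Pproj p0.
have hS : h \in star_space (cover_obj (syzygy M)) by apply/star_spaceP.
exists (quotv_pi (limg (star_map (res_diff M 0))) (Subvs hS)).
rewrite quotv_pi_eq0; apply: contraNN hv => /memv_imgP[f _ /(congr1 vsval)].
rewrite (star_mapE _ (res_diff_hom M 0)) => hE.
have fh : @bim_hom k A B (res_obj M 0) tens (vsval f).
  by apply/star_spaceP; apply: subvsP.
have := @res_diff_rad M 0 v _ (character_comp fh tens_aug_character).
rewrite (comp_lfunE tens_aug) => aug0; apply/eqP; rewrite -[RHS]aug0; congr (tens_aug _).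
exact: etrans (congr1 (fun g : 'Hom(res_obj M 1, tens) => g v) hE) (comp_lfunE _ _ _).
Qed.

Lemma tau_neq0 M (w : syzygy M) : w != 0 -> exists z : tau M, z != 0.
Proof.
case/transpose_neq0=> z /functional_exists[phi pz]; exists phi.
by apply: contraNneq pz => ->; rewrite zero_lfunE.
Qed.

(** Over a local algebra, X maps onto the simple bimodule and Y contains it. *)
Lemma bim_hom_neq0 X Y (x : X) (y : Y) : x != 0 -> y != 0 ->
  exists f : subvs_of (bim_homspace X Y), f != 0.
Proof.
move=> /(character_exists eA eB)[phi [/lfun_neq0[v pv] [pl pr]]] y0.
have Ys : @bim_stable k A B Y fullv by split=> *; rewrite memvf.
have [z [_ z0 zl zr]] := socle_exists eA eB Ys (memvf y) y0.
have fL : linear (fun u => (phi u : k) *: z).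
  by move=> c u u'; rewrite linearP scalerDl scalerA.
have fh : mklfun fL \in bim_homspace X Y.
  apply/bim_homspaceP/bim_homP; split=> c u; rewrite !mklfunE.
    by rewrite linearZ /= zl pl !scalerA mulrC.
  by rewrite linearZ /= zr pr !scalerA mulrC.
exists (Subvs fh); apply: contraNneq pv => /(congr1 val)/lfunP/(_ v) /eqP.
by rewrite mklfunE zero_lfunE scaler_eq0 (negPf z0) orbF.
Qed.

End ProjectiveCovers.

(** * Minimal resolutions of modules and Tor *)

(** One-sided modules are bimodules with k on the other side, so k itself is
    needed as an augmented local algebra. *)
Fact scalar_aug_nil (k : fieldType) : exists n, forall s : seq (k^o : falgType k),
  size s = n -> (forall a, a \in s -> a = 0) -> \prod_(a <- s) a = 0.
Proof.
by exists 1%N => -[|a []] // _ /(_ a); rewrite big_seq1 mem_head; apply.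
Qed.

Definition scalar_aug (k : fieldType) : local_aug (k^o : falgType k) :=
  @LocalAug k (k^o : falgType k) id (fun _ _ _ => erefl) (conj erefl (fun _ _ => erefl))
    (scalar_aug_nil k).

Section Tor.
Variables (k : fieldType) (L : falgType k) (e : local_aug L).
Variables (S : rmodule k L) (S_aug : forall a m, ract S a m = e a *: m).
Local Notation in_rad := (in_rad e (scalar_aug k)).
Implicit Types N P : lmodule k L.

Fact pure_tensr_linear (V W : vectType k) (m : V) : linear (@pure_tens k V W m).
Proof.
move=> c v w; apply/lfunP=> phi.
by rewrite add_lfunE scale_lfunE !pure_tensE scalerDr scalerA mulrC -scalerA.
Qed.

(** If psi vanishes on the balancing relations, then p |-> psi(m (x) p) is a
    character of P, since L acts on m through the augmentation. *)
Lemma rad_balancing P m (v : P) : in_rad v -> pure_tens m v \in balancing S P.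
Proof.
move=> vr; apply/vspanP=> W WP; case: (boolP (_ \in W)) => // /functional_separates.
case=> psi [psiW /eqP[]]; pose phi : dualv P := (psi \o mklfun (@pure_tensr_linear S P m))%VF.
have phiE w : phi w = psi (pure_tens m w) by rewrite (comp_lfunE psi) mklfunE.
rewrite -phiE; apply: vr; apply: characterP => [a w ea|b w /= ->]; last first.
  by rewrite ract0v linear0.
have/psiW : pure_tens (ract S a m) w - pure_tens m (lact P a w) \in W.
  by apply: WP; exists m, a, w.
rewrite S_aug ea scale0r linearB phiE => /subr0_eq <-.
suff -> : pure_tens (0 : S) w = 0 by rewrite linear0.
by apply/lfunP=> chi; rewrite pure_tensE linear0 scale0r zero_lfunE.
Qed.

(** Minimality of the resolution: tensoring with a semisimple module kills the
    radical, hence every differential. *)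
Lemma tor_diff_eq0 N n : tor_diff S N n = 0.
Proof.
apply/lfunP=> z; rewrite zero_lfunE /tor_diff /tens_over_map.
rewrite (comp_lfunE (quotv_pi _)); apply/eqP; rewrite quotv_pi_eq0.
rewrite (comp_lfunE (tens_map _ _)) [X in tens_map _ _ X](tensv_sum _) linear_sum.
apply: rpred_sum => i _; rewrite [X in X \in _]tens_map_pure; apply: rad_balancing.
exact: (@res_diff_rad k L _ e (scalar_aug k) N n).
Qed.

(** The tensor product of linear forms chi on S and phi on P, with phi a character,
    respects the balancing relations. *)
Lemma tens_over_neq0 P (m : S) (p : P) : m != 0 -> p != 0 ->
  exists z : tens_over S P, z != 0.
Proof.
move=> /functional_exists[chi chim].
move=> /(character_exists e (scalar_aug k))[phi [/lfun_neq0[v pv] [pl _]]].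
exists (quotv_pi (balancing S P) (pure_tens m v)); rewrite quotv_pi_eq0.
have xiL : linear (fun t : tensv S P => phi (t chi) : k^o).
  by move=> c t t'; rewrite add_lfunE scale_lfunE linearP.
have phiZ c u : phi (c *: u) = c * phi u by rewrite linearZ.
have phiB u u' : phi (u - u') = phi u - phi u' by rewrite linearB.
have chiZ c u : chi (c *: u) = c * chi u by rewrite linearZ.
apply/negP => /vspanP/(_ (lker (mklfun xiL))) H.
have : pure_tens m v \in lker (mklfun xiL).
  apply: H => _ [m' [a [w ->]]]; rewrite memv_ker mklfunE add_lfunE opp_lfunE !pure_tensE.
  by rewrite S_aug chiZ phiB !phiZ pl mulrCA mulrA subrr.
by rewrite memv_ker mklfunE pure_tensE linearZ /= mulf_eq0 (negPf chim) (negPf pv).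
Qed.

(** All differentials vanish, so Tor_n(S, N) is the whole of S (x) P_n. *)
Lemma Tor_neq0 N n (m : S) (w : syzygy_n n N) : m != 0 -> w != 0 ->
  exists z : Tor S N n, z != 0.
Proof.
move=> m0 /(cover_neq0 e (scalar_aug k))[p /(tens_over_neq0 m0)[z z0]].
suff zC : z \in (tor_cycles S N n :\: limg (tor_diff S N n))%VS.
  by exists (Subvs zC); apply: contraNneq z0 => /(congr1 val) /= ->; apply: eqxx.
have -> : tor_cycles S N n = fullv.
  by case: (n) => //= n'; apply/vspaceP=> v; rewrite tor_diff_eq0 memv_ker zero_lfunE eqxx memvf.
rewrite tor_diff_eq0 lim0g.
rewrite (_ : (fullv :\: 0)%VS = fullv) ?memvf //; exact: diffv0f.
Qed.

End Tor.

(** * Coefficients in the path algebra *)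

Section PathCoefficients.
Variables (k : fieldType) (Q : quiver).
Local Notation kQ := (path_algebra k Q).
Implicit Types (f g : kQ) (a : arrow Q).

Lemma sum_mcoeff f (p0 : qpath Q) :
  \sum_(p <- msupp f) f@_p * (p == p0)%:R = f@_p0.
Proof.
rewrite {3}[f]paE raddf_sum; apply: eq_bigr => p _ /=.
by rewrite mcoeffZ mcoeffU.
Qed.

Lemma mcoeff_arrow_mul f g a : (f * g)@_(arrow_path a) =
  f@_(triv_path (tgt a)) * g@_(arrow_path a) + f@_(arrow_path a) * g@_(triv_path (src a)).
Proof.
have UU p q : (path_mul k p q)@_(arrow_path a) =
    (p == triv_path (tgt a))%:R * (q == arrow_path a)%:R +
    (p == arrow_path a)%:R * (q == triv_path (src a))%:R.
  case: (@eqP _ (qsrc p) (qtgt q)) => [h|h]; last first.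
    rewrite path_mul0 // mcoeff0.
    case: (eqVneq p (triv_path _)) => [pE|_]; case: (eqVneq q (arrow_path a)) => [qE|_];
      try (by case: h; rewrite pE qE);
      case: (eqVneq p (arrow_path a)) => [pE'|_];
      case: (eqVneq q (triv_path (src a))) => [qE'|_];
      try (by case: h; rewrite pE' qE'); by rewrite ?mul0r ?mulr0 ?addr0.
  rewrite path_mulE mcoeffU.
  case: p q h => [[y s] wp] [[z t] wq] h; rewrite -!val_eqE /= !xpair_eqE.
  move: h; rewrite /qsrc /qtgt /=; case: s wp => [|b [|c s]] wp h /=;
    rewrite ?eqseq_cons ?andbF ?mul0r ?addr0 ?add0r ?mul0r //.
    by case: (t =P [:: a]) h => [->|_] /= h; rewrite ?h ?eqxx ?andbF ?mulr0 ?mul1r.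
  have /andP[/eqP/= by_ _] := wp; case: (b =P a) => [ba|_]; last by rewrite !andbF mul0r.
  by rewrite -by_ ba eqxx mul1r.
rewrite -(sum_mcoeff f (triv_path _)) -(sum_mcoeff g (arrow_path a)).
rewrite -(sum_mcoeff f (arrow_path a)) -(sum_mcoeff g (triv_path _)).
rewrite !big_distrlr -big_split /= -[f * g]/(pa_mul f g) pa_mulE.
rewrite raddf_sum; apply: eq_bigr => p _; rewrite raddf_sum -big_split; apply: eq_bigr => q _ /=.
by rewrite mcoeffZ UU mulrDr; congr (_ + _); apply: mulrACA.
Qed.

Lemma ideal_scale (J : kQ -> Prop) c f : is_ideal J -> J f -> J (c *: f).
Proof.
case=> _ _ Jl _ Jf; rewrite -[f]mul1r -[1 * f]/(pa_mul 1 f) -pa_mulZl.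
exact: Jl.
Qed.

(** A non trivial path is an arrow times a path. *)
Lemma arrow_ideal_mcoeff f : (forall x, f@_(triv_path x) = 0) -> arrow_ideal f.
Proof.
move=> f0 J Jid JF; rewrite [f]paE; have [J0 JD _ Jr] := Jid.
apply: (big_ind J) => // p _; case: p => [[x [|a s]] wp] /=.
  suff -> : QPath wp = triv_path x by rewrite f0 scale0r.
  exact/val_inj.
apply: ideal_scale => //; have /andP[/eqP as_ ws] := wp.
pose q := @QPath Q (x, s) ws.
have h : qsrc (arrow_path a) = qtgt q by rewrite /qsrc /qtgt /= as_.
have -> : path_elt k (QPath wp) = path_elt k (arrow_path a) * path_elt k q.
  rewrite -[RHS]/(pa_mul _ _) pa_mulUU (path_mulE _ h); congr path_elt.
  exact/val_inj.
by apply: Jr; apply: JF; exists a.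
Qed.

(** In a product of two elements without trivial paths every path has length at
    least two. *)
Lemma ideal_two_arrow f a : ideal_exp (@arrow_ideal k Q) 2 f -> f@_(arrow_path a) = 0.
Proof.
pose J := fun f : kQ => (forall x, f@_(triv_path x) = 0) /\ f@_(arrow_path a) = 0.
have Jid : is_ideal J.
  split=> [|f1 f2 [f1t f1a] [f2t f2a]|h f1 [f1t f1a]|f1 h [f1t f1a]].
  - by split=> [x|]; rewrite mcoeff0.
  - by split=> [x|]; rewrite mcoeffD ?f1t ?f2t ?f1a ?f2a addr0.
  - by split=> [x|]; rewrite ?mcoeff_triv_mul ?mcoeff_arrow_mul ?f1t ?f1a !mulr0 ?addr0.
  - by split=> [x|]; rewrite ?mcoeff_triv_mul ?mcoeff_arrow_mul ?f1t ?f1a !mul0r ?addr0.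
suff H : forall g, ideal_exp (@arrow_ideal k Q) 2 g -> J g by move/H => -[].
move=> g /(_ J Jid); apply=> _ [g1 [g2 [g1F g2F ->]]].
have g1t x := arrow_ideal_triv x g1F.
have g2t x : g2@_(triv_path x) = 0.
  have := g2F _ (ideal_triv_eq0 k x); apply=> _ [h1 [h2 [/(arrow_ideal_triv x) h1t _ ->]]].
  by rewrite mcoeff_triv_mul h1t mul0r.
by split=> [x|]; rewrite ?mcoeff_triv_mul ?mcoeff_arrow_mul ?g1t ?g2t !(mul0r,mulr0) ?addr0.
Qed.

End PathCoefficients.

(** * Local bound quiver algebras *)

Section LocalBoundQuiver.
Variables (k : fieldType) (L : bound_quiver_algebra k).
Local Notation Q := (bqa_quiver L).

(** This is where the inclusion of I in the square of the arrow ideal enters. *)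
Lemma bqa_arrow_neq0 a : bqa_proj L (path_elt k (arrow_path a)) != 0.
Proof.
apply/eqP => /bqa_proj_ker; have [_ [m [_ _ IF2]]] := bqa_admissible L.
by move/IF2/(ideal_two_arrow a)/eqP; rewrite mcoeffUU oner_eq0.
Qed.

Lemma bqa_char_arrow x a : bqa_char x (bqa_proj L (path_elt k (arrow_path a))) = 0.
Proof. by rewrite bqa_charE mcoeffU; case: eqP => // /(congr1 val)[]. Qed.

(** With a single vertex, an element without constant term comes from the arrow
    ideal F, and some power of F is contained in I. *)
Lemma bqa_char_nil (x : vert Q) : #|vert Q| = 1%N -> exists n, forall s : seq L,
  size s = n -> (forall a, a \in s -> bqa_char x a = 0) -> \prod_(a <- s) a = 0.
Proof.
move=> Q1; have [_ [m [_ FI _]]] := bqa_admissible L; exists m => s sm sJ.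
have [p1 pM] := bqa_proj_morph L.
suff [f [<- fF]] : exists f, bqa_proj L f = \prod_(a <- s) a /\
    ideal_exp (@arrow_ideal k Q) (size s) f.
  by apply/bqa_proj_ker/FI; rewrite -sm.
elim: s sJ {sm} => [|a s IH] sJ; first by exists 1; rewrite big_nil.
have [|f [fE fF]] := IH; first by move=> b bs; apply: sJ; rewrite inE bs orbT.
have [g ga] := bqa_proj_surj a; exists (g * f); rewrite pM big_cons ga fE; split=> //.
move=> J Jid; apply; exists g, f; split=> //; apply: arrow_ideal_mcoeff => y.
have -> : y = x by apply: (fintype_le1P _); rewrite ?Q1.
by rewrite -bqa_charE ga sJ ?mem_head.
Qed.

Definition bqa_aug (x : vert Q) (Q1 : #|vert Q| = 1%N) : local_aug L :=
  @LocalAug k L (bqa_char x) (bqa_char_linear x) (bqa_char_monoid_morphism x) (bqa_char_nil x Q1).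

Lemma path_space_diag x : path_space_neq0 (L := L) x x.
Proof.
exists 1; apply/eqP => /(congr1 (bqa_char x)).
have [c1 cM] := bqa_char_monoid_morphism x.
rewrite !cM c1 /idem bqa_charE mcoeffUU !mulr1 => /eqP; apply/negP.
have -> : bqa_char x 0 = 0.
  by have := bqa_char_linear x (-1) 0 0; rewrite scaler0 addr0 mulN1r addNr.
exact: oner_neq0.
Qed.

End LocalBoundQuiver.

(** * The four infinite graded spaces *)

Theorem proposition6p1 (k : fieldType) (L : bound_quiver_algebra k)
  (hL : nontrivial_local L) :
  [/\ infinite_plus_gldim L,
      infinite_coplus_gldim L,
      infinite_graded (HHtau_hom (regular_bimodule L)) &
      infinite_graded (HHtau_coh (regular_bimodule L))].
Proof.
have [Q1 /card_gt0P[a _]] := hL; pose x := src a.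
pose e := bqa_aug x Q1; pose j : L := bqa_proj L (path_elt k (arrow_path a)).
have ej : e j = 0 := bqa_char_arrow x a.
have j0 : j != 0 := bqa_arrow_neq0 a.
(* The augmentation ideal is a non zero sub-bimodule of L; s spans a simple
   sub-bimodule of it, so that s * s = 0. *)
have [J JP] : exists J : {vspace L}, forall b, b \in J <-> e b = 0.
  apply: vspace_exists => [|c u v eu ev]; first exact: aug0.
  by rewrite aug_linear eu ev mulr0 addr0.
have Jstable : @bim_stable k L L (regular_bimodule L) J.
  split=> c u /JP eu; apply/JP.
    by rewrite [lact _ c u]lfunE [e _]augM eu mulr0.
  by rewrite [ract _ c u]lfunE [e _]augM eu mul0r.
have [s [/JP es s0 sr sl]] := socle_exists e e Jstable (proj2 (JP j) ej) j0.
have {}sl b : s * b = e b *: s by have := sl b; rewrite /= lfunE.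
have {}sr b : b * s = e b *: s by have := sr b; rewrite /= lfunE.
have TorInf : infinite_graded (Tor (simple_right x) (simple_left x)).
  move=> N; exists N; split=> //.
  have k10 : (1 : k^o) != 0 := oner_neq0 k.
  have ract_aug b (m : simple_right x) : ract (simple_right x) b m = e b *: m.
    by rewrite /= scale_lfunE id_lfunE.
  have unit_socle (b : k^o) : b * 1 = scalar_aug k b *: (1 : k^o) by [].
  (* Left modules: s kills the simple module because s is in the radical. *)
  have simple_killed : killed s 1 (simple_left x).
    by move=> v; rewrite /= scale_lfunE -[bqa_char x s]/(e s) es scale0r.
  have [_ [w w0]] := @syzygy_n_neq0 k _ _ e (scalar_aug k) s 1 s0 k10 sl unit_socle
    (simple_left x) (1 : k^o) N simple_killed k10.
  exact: (@Tor_neq0 k L e (simple_right x) ract_aug (simple_left x) N (1 : k^o) w k10 w0).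
have reg1 : (1 : regular_bimodule L) != 0 by exact: oner_neq0.
(* Bimodules: s v s = e(v) s s = 0. *)
have regular_killed : killed s s (regular_bimodule L).
  by move=> v; rewrite /= !lfunE /= sr -scalerAr sl es scale0r scaler0.
have tau0 n : exists z : tau_n n.+1 (regular_bimodule L), z != 0.
  have [_ [w w0]] := syzygy_n_neq0 s0 s0 sl sr n.+1 regular_killed reg1.
  exact: (tau_neq0 e e w0).
have dreg : exists phi : dual_bimodule (regular_bimodule L), phi != 0.
  have [phi p1] := functional_exists reg1; exists phi.
  by apply: contraNneq p1 => ->; rewrite zero_lfunE.
split.
- by exists x, x; split=> //; apply: path_space_diag.
- by exists x, x; split=> //; apply: path_space_diag.
- move=> N; exists N.+1; split=> //; have [z z0] := tau0 N; have [phi p0] := dreg.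
  exact: (bim_hom_neq0 e e p0 z0).
- move=> N; exists N.+1; split=> //; have [z z0] := tau0 N.
  have [f /functional_exists[chi chif]] := bim_hom_neq0 e e reg1 z0.
  by exists chi; apply: contraNneq chif => ->; rewrite zero_lfunE.
Qed.
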